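(* Let $k$ be a positive integer, let $\mu,\nu$ be in $\mathcal{D}_{\mathrm{alg}}(k)$ such that $\mu$ is tracial, and let $\mu':=\Psi_k(\nu)\in\mathcal{D}'_{\mathrm{alg}}(k)$. Then the infinitesimal free cumulants $(\kappa'_n)_{n=1}^\infty$ of $(\mu,\mu')$ are related to the c-free cumulants $(\kappa^{(c)}_n)_{n=1}^\infty$ of $(\mu,\nu)$ by the formula $$\kappa'_n(X_{i_1},\ldots,X_{i_n})=\sum_{m=1}^n\kappa^{(c)}_{n+1}(X_{i_m},\ldots,X_{i_n},X_{i_1},\ldots,X_{i_m}),$$ holding for every $n\in\mathbb{N}$ and $i_1,\ldots,i_n\in\{1,\ldots,k\}$.
   Context: Here $\mathbb{N}=\{1,2,\ldots\}$. Distributions. $\mathbb{C}\langle X_1,\ldots,X_k\rangle$ is the algebra of polynomials in non-commuting indeterminates. $\mathcal{D}_{\mathrm{alg}}(k)$ is the set of linear functionals $\mu$ on it with $\mu(1)=1$, and $\mathcal{D}'_{\mathrm{alg}}(k)$ is the set of linear functionals $\mu'$ on it with $\mu'(1)=0$. $\mu$ is tracial if $\mu(PQ)=\mu(QP)$ for all $P,Q$. Partitions. $NC(n)$ is the set of non-crossing partitions of $\{1,\ldots,n\}$; $\mathrm{Int}(n)\subseteq NC(n)$ is the set of interval partitions (every block is a set of consecutive integers). A block $V$ of $\pi\in NC(n)$ is inner if there is a block $W$ of $\pi$ with $\min W<\min V\le\max V<\max W$; otherwise it is outer. For $M=\{i_1<\cdots<i_m\}\subseteq\{1,\ldots,n\}$,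 $(x_1,\ldots,x_n)\mid M:=(x_{i_1},\ldots,x_{i_m})$. Cumulants. Let $\mathcal{A}=\mathbb{C}\langle X_1,\ldots,X_k\rangle$, let $\mu,\nu\in\mathcal{D}_{\mathrm{alg}}(k)$ and $\mu'\in\mathcal{D}'_{\mathrm{alg}}(k)$. The following families of multilinear functionals $\mathcal{A}^n\to\mathbb{C}$, $n\ge1$, are uniquely determined by the stated identities, required for all $n\geq 1$ and $x_1,\ldots,x_n\in\mathcal{A}$. - Free cumulants $\kappa_{n;\mu}$ of $\mu$: $\mu(x_1\cdots x_n)=\sum_{\pi\in NC(n)}\prod_{V\in\pi}\kappa_{|V|;\mu}((x_1,\ldots,x_n)\mid V)$. - Boolean cumulants $\beta_{n;\nu}$ of $\nu$: $\nu(x_1\cdots x_n)=\sum_{\pi\in \mathrm{Int}(n)}\prod_{V\in\pi}\beta_{|V|;\nu}((x_1,\ldots,x_n)\mid V)$. - c-free cumulants $\kappa^{(c)}_{n}$ of $(\mu,\nu)$: $\nu(x_1\cdots x_n)=\sum_{\pi\in NC(n)}\prod_{V\in\pi\text{ inner}}\kappa_{|V|;\mu}((x_1,\ldots,x_n)\mid V)\prod_{W\in\pi\text{ outer}}\kappa^{(c)}_{|W|}((x_1,\ldots,x_n)\mid W)$. - Infinitesimal free cumulants $\kappa'_{n}$ of $(\mu,\mu')$: $\mu'(x_1\cdots x_n)=\sum_{\pi\in NC(n)}\sum_{V_o\in\pi}\kappa'_{|V_o|}((x_1,\ldots,x_n)\mid V_o)\prod_{V\in\pi, V\ne V_o}\kappa_{|V|;\mu}((x_1,\ldots,x_n)\mid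 V)$. The map $\Psi_k:\mathcal{D}_{\mathrm{alg}}(k)\to\mathcal{D}'_{\mathrm{alg}}(k)$. For $\nu\in\mathcal{D}_{\mathrm{alg}}(k)$, $\Psi_k(\nu)=\mu'$ is the functional in $\mathcal{D}'_{\mathrm{alg}}(k)$ determined by $\mu'(X_{i_1}\cdots X_{i_n})=\sum_{m=1}^n\beta_{n+1;\nu}(X_{i_m},\ldots,X_{i_n},X_{i_1},\ldots,X_{i_m})$ for all $n\ge1$ and $i_1,\ldots,i_n\in\{1,\ldots,k\}$. *)

(* Defs.v *)
From HB Require Import structures.
From mathcomp Require Import all_boot all_order all_algebra.
From mathcomp Require Import boolp reals complex.
From mathcomp Require Import monalg.

Set Implicit Arguments.
Unset Strict Implicit.
Unset Printing Implicit Defensive.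

Import GRing.Theory.
Local Open Scope ring_scope.

(* The algebra C<X_1, ..., X_k> is the monoid algebra over R[i] of the free
   monoid on 'I_k, so the indeterminates are indexed by 0, ..., k.-1. *)
Notation ncpoly R k := {malg R[i][{fmonom 'I_k}]}.

Definition ncX (R : realType) (k : nat) (j : 'I_k) : ncpoly R k := << fmu j >>.

Record Dalg (R : realType) (k : nat) := MkDalg {
  Dalg_fun :> {scalar ncpoly R k};
  Dalg_one : Dalg_fun 1 = 1 }.

Record Dalg' (R : realType) (k : nat) := MkDalg' {
  Dalg'_fun :> {scalar ncpoly R k};
  Dalg'_one : Dalg'_fun 1 = 0 }.

Definition tracial (R : realType) (k : nat) (mu : Dalg R k) :=
  forall P Q : ncpoly R k, mu (P * Q) = mu (Q * P).

Definition noncrossing (n : nat) (P : {set {set 'I_n}}) : bool :=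
  [forall V in P, forall W in P, (V != W) ==>
    ~~ [exists a in V, exists b in W, exists c in V, exists d in W,
        [&& (a < b)%N, (b < c)%N & (c < d)%N]]].

Definition NC (n : nat) : {set {set {set 'I_n}}} :=
  [set P | partition P [set: 'I_n] & noncrossing P].

Definition Int (n : nat) : {set {set {set 'I_n}}} :=
  [set P | partition P [set: 'I_n] &
    [forall V in P, forall a in V, forall b in V, forall c : 'I_n,
      ((a <= c)%N && (c <= b)%N) ==> (c \in V)]].

(* Minimum and maximum of a nonempty block; n and 0 are neutral for values below n. *)
Definition blockmin (n : nat) (V : {set 'I_n}) : nat :=
  \big[minn/n]_(i in V) (i : nat).
Definition blockmax (n : nat) (V : {set 'I_n}) : nat :=
  \max_(i in V) (i : nat).

Definition inner_block (n : nat) (P : {set {set 'I_n}}) (V : {set 'I_n}) : bool :=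
  [exists W in P, [&& (blockmin W < blockmin V)%N,
                      (blockmin V <= blockmax V)%N
                    & (blockmax V < blockmax W)%N]].

(* (x_1, ..., x_n) | V: enum V lists V in increasing order. *)
Definition restr (T : Type) (n : nat) (x : n.-tuple T) (V : {set 'I_n}) :
  seq T := [seq tnth x i | i <- enum V].

(* A family of functionals A^n -> C, n >= 1, is encoded as one function on
   sequences, whose restriction to sequences of size n is the n-th functional;
   its value at the empty sequence plays no role. *)
Definition cumfamily (R : realType) (k : nat) := seq (ncpoly R k) -> R[i].

Definition multilinear (R : realType) (k : nat) (K : cumfamily R k) :=
  forall (s t : seq (ncpoly R k)) (a : R[i]) (x y : ncpoly R k),
    K (s ++ (a *: x + y) :: t) = a * K (s ++ x :: t) + K (s ++ y :: t).

Lemma ncpoly_scaleAr (R : realType) (k : nat) (a : R[i]) (p q : ncpoly R k) :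
  p * (a *: q) = a *: (p * q).
Proof.
have ca : p * a%:MP = a%:MP * p.
  have -> : p * a%:MP = _ := fgmulgU a _ p.
  have -> : a%:MP * p = _ := fgmulUg a _ p.
  by apply: eq_bigr => m _; rewrite mulrC mulm1 mul1m.
have -> : a *: q = a%:MP * q by rewrite mul_malgC.
by rewrite mulrA ca -mulrA; exact: mul_malgC.
Qed.

(* Existence and uniqueness of the cumulants. All four defining identities
   have the shape
   F x = \sum_(P in S n) \sum_(j in J P) \prod_(V in P) f K P j V (restr x V),
   and can be solved for K by recursion on n. *)

Lemma restrT (T : Type) (n : nat) (x : n.-tuple T) : restr x setT = x.
Proof. by rewrite /restr enum_setT -enumT map_tnth_enum. Qed.

Lemma part_block_size (n : nat) (P : {set {set 'I_n}}) (V : {set 'I_n}) :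
  (0 < n)%N -> partition P setT -> P != [set setT] -> V \in P ->
  (0 < #|V| < n)%N.
Proof.
move=> n0 /and3P[/eqP cP tP P0] PT VP; apply/andP; split.
  by rewrite card_gt0; apply: contraNneq P0 => <-.
rewrite -[X in (_ < X)%N]card_ord -cardsT; apply: proper_card.
rewrite properT; apply: contraNneq PT => VT.
apply/eqP/setP=> W; rewrite in_set1; apply/idP/eqP=> [WP|->]; last by rewrite -VT.
apply/eqP; apply/negPn/negP => WT.
have /set0Pn[i iW] : W != set0 by apply: contraNneq P0 => <-.
have dVW : [disjoint V & W] by apply: (trivIsetP tP) => //; rewrite VT eq_sym.
by have := disjointFl dVW iW; rewrite VT inE.
Qed.

Lemma partT (n : nat) : (0 < n)%N -> partition [set [set: 'I_n]] setT.
Proof.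
move=> n0; rewrite /partition /cover big_set1 eqxx /=.
rewrite in_set1 eq_sym -card_gt0 cardsT card_ord n0 andbT.
by apply/trivIsetP => A B /set1P-> /set1P->; rewrite eqxx.
Qed.

Lemma NC_T (n : nat) : (0 < n)%N -> [set [set: 'I_n]] \in NC n.
Proof.
move=> n0; rewrite inE partT //=; apply/forall_inP => A /set1P->.
by apply/forall_inP => B /set1P->; rewrite eqxx.
Qed.

Lemma Int_T (n : nat) : (0 < n)%N -> [set [set: 'I_n]] \in Int n.
Proof.
move=> n0; rewrite inE partT //=; apply/forall_inP => A /set1P->.
apply/forall_inP => a _; apply/forall_inP => b _; apply/forallP => c.
by rewrite inE implybT.
Qed.

Lemma inner_partT (n : nat) : inner_block [set [set: 'I_n]] setT = false.
Proof.
by apply/negbTE/exists_inP => -[A /set1P-> /and3P[]]; rewrite ltnn.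
Qed.

Lemma size_restr (T : Type) (n : nat) (x : n.-tuple T) V :
  size (restr x V) = #|V|.
Proof. by rewrite size_map -cardE. Qed.

(* A family that is multilinear on sequences of size n only. *)
Definition mln (R : realType) (k : nat) (K : cumfamily R k) (n : nat) :=
  forall (s t : seq (ncpoly R k)) (a : R[i]) (x y : ncpoly R k),
    (size s + size t).+1 = n ->
    K (s ++ (a *: x + y) :: t) = a * K (s ++ x :: t) + K (s ++ y :: t).

Lemma restr_mask (T : Type) (n : nat) (x : n.-tuple T) V :
  restr x V = mask [seq i \in V | i <- enum 'I_n] x.
Proof.
rewrite /restr -[in RHS](map_tnth_enum x) -map_mask -filter_mask.
by congr map; rewrite enumT; apply: eq_filter.
Qed.

Lemma mln_prod (R : realType) (k n : nat) (P : {set {set 'I_n}})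
    (f : {set 'I_n} -> cumfamily R k) :
  partition P setT -> (forall V, V \in P -> mln (f V) #|V|) ->
  forall (s t : seq (ncpoly R k)) (a : R[i]) (x y : ncpoly R k)
    (tz tx ty : n.-tuple (ncpoly R k)),
  tz = s ++ (a *: x + y) :: t :> seq _ -> tx = s ++ x :: t :> seq _ ->
  ty = s ++ y :: t :> seq _ ->
  \prod_(V in P) f V (restr tz V) =
  a * \prod_(V in P) f V (restr tx V) + \prod_(V in P) f V (restr ty V).
Proof.
move=> /and3P[/eqP cP tP P0] fP s t a x y tz tx ty ez ex ey.
have sn : (size s < n)%N.
  by rewrite -(size_tuple tz) ez size_cat /= -addSnnS leq_addr.
pose i0 := Ordinal sn.
have i0P : i0 \in cover P by rewrite cP inE.
have V0P := pblock_mem i0P; have i0V0 : i0 \in pblock P i0 by rewrite mem_pblock.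
pose m (V : {set 'I_n}) := [seq i \in V | i <- enum 'I_n].
have sm V : size (m V) = n by rewrite size_map size_enum_ord.
have split_m V : m V = take (size s) (m V) ++ (i0 \in V) :: drop (size s).+1 (m V).
  rewrite -[LHS](cat_take_drop (size s)); congr cat.
  rewrite (drop_nth false) ?sm //; congr cons.
  rewrite (nth_map i0) ?size_enum_ord //.
  by rewrite (_ : nth _ _ _ = i0) //; apply: val_inj; rewrite /= nth_enum_ord.
have rE V w (tw : n.-tuple (ncpoly R k)) : tw = s ++ w :: t :> seq _ ->
    restr tw V = mask (take (size s) (m V)) s ++
      nseq (i0 \in V) w ++ mask (drop (size s).+1 (m V)) t.
  move=> ew; rewrite restr_mask -/(m V) ew {1}split_m mask_cat ?mask_cons //.
  by rewrite size_takel // sm ltnW.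
have D (g : n.-tuple (ncpoly R k)) : \prod_(V in P) f V (restr g V) =
    f (pblock P i0) (restr g (pblock P i0)) *
    \prod_(V in P | V != pblock P i0) f V (restr g V).
  by rewrite (bigD1 (pblock P i0)).
rewrite (D tz) (D tx) (D ty) {D}.
have other (g : n.-tuple _) w : g = s ++ w :: t :> seq _ ->
    \prod_(V in P | V != pblock P i0) f V (restr g V) =
    \prod_(V in P | V != pblock P i0) f V (restr tz V).
  move=> eg; apply: eq_bigr => V /andP[VP VV].
  rewrite (rE V _ _ eg) (rE V _ _ ez).
  have -> // : (i0 \in V) = false.
  apply/negbTE; apply: contraNN VV => iV; apply/eqP.
  by rewrite (def_pblock tP VP iV).
rewrite (other tx _ ex) (other ty _ ey) mulrA -mulrDl; congr (_ * _).
rewrite (rE _ _ _ ez) (rE _ _ _ ex) (rE _ _ _ ey) i0V0 /=.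
apply: (fP _ V0P).
have := size_restr tx (pblock P i0).
by rewrite (rE _ _ _ ex) i0V0 /= size_cat /= addnS.
Qed.

Lemma solve_family (R : realType) (k : nat) (F : cumfamily R k)
    (H : cumfamily R k -> cumfamily R k) :
  (forall n, mln F n) ->
  (forall K K' x, (0 < size x)%N ->
     (forall y, (0 < size y < size x)%N -> K y = K' y) -> H K x = H K' x) ->
  (forall K n, (forall m, (0 < m < n)%N -> mln K m) -> mln (H K) n) ->
  exists K : cumfamily R k,
    multilinear K /\ forall x, (0 < size x)%N -> F x = K x + H K x.
Proof.
move=> Fl Hloc Hml.
pose step (K : cumfamily R k) : cumfamily R k := fun x => F x - H K x.
pose it j := iter j step (fun=> 0).
have itE d x : forall j j', (0 < size x)%N -> (size x <= d)%N ->
    (size x <= j)%N -> (size x <= j')%N -> it j x = it j' x.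
  elim: d x => [|d IH] x j j' x0 xd xj xj'.
    by move: x0; rewrite ltnNge xd.
  case: j j' xj xj' => [|j] [|j'] xj xj'; rewrite ?leqn0 in xj xj' *;
    try by rewrite ?(eqP xj) ?(eqP xj') in x0.
  rewrite /it /= /step; congr (_ - _); apply: Hloc => // y /andP[y0 yx].
  have yx' := leq_trans yx.
  by apply: IH => //; rewrite -ltnS; apply: yx'.
pose K : cumfamily R k := fun x => it (size x) x.
have KE x : (0 < size x)%N -> K x = F x - H K x.
  move=> x0; rewrite /K.
  rewrite (itE (size x) x _ (size x).+1) //= /step; congr (_ - _).
  apply: Hloc => // y /andP[y0 yx]; apply: (itE (size y)) => //; exact: ltnW.
exists K; split; last by move=> x x0; rewrite KE // subrK.
have Kml n : mln K n.
  elim/ltn_ind: n => n IH s t a x y sn.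
  have sz w : (0 < size (s ++ w :: t))%N by rewrite size_cat /= addnS.
  rewrite !KE // (Fl n) // (Hml K n) //; last by move=> m /andP[_ ?]; apply: IH.
  by rewrite mulrBr opprD addrACA.
by move=> s t a x y; apply: Kml.
Qed.

Lemma solve_cumulants (R : realType) (k : nat) (phi : {scalar ncpoly R k})
    (S : forall n, {set {set {set 'I_n}}})
    (J : forall n, {set {set 'I_n}} -> {set {set 'I_n}})
    (f : cumfamily R k -> forall n, {set {set 'I_n}} -> {set 'I_n} -> {set 'I_n} ->
         cumfamily R k) :
  (forall n P, P \in S n -> partition P setT) ->
  (forall n, (0 < n)%N -> [set setT] \in S n) ->
  (forall n, J n [set setT] = [set setT]) ->
  (forall K n, f K n [set setT] setT setT =1 K) ->
  (forall K n P j V m, mln K m -> mln (f K n P j V) m) ->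
  (forall K K' n P j V y, K y = K' y -> f K n P j V y = f K' n P j V y) ->
  exists K : cumfamily R k, multilinear K /\
    forall n (x : n.-tuple (ncpoly R k)), (0 < n)%N ->
      phi (\prod_(y <- x) y) =
      \sum_(P in S n) \sum_(j in J n P) \prod_(V in P) f K n P j V (restr x V).
Proof.
move=> Spart ST JT fT fml floc.
pose H (K : cumfamily R k) : cumfamily R k := fun s =>
  \sum_(P in S (size s) | P != [set setT]) \sum_(j in J _ P)
     \prod_(V in P) f K _ P j V (restr (in_tuple s) V).
have HE K n (x : n.-tuple (ncpoly R k)) : H K x =
    \sum_(P in S n | P != [set setT]) \sum_(j in J _ P)
     \prod_(V in P) f K _ P j V (restr x V).
  case: x => s sn; have e := eqP sn; subst n; rewrite /H /=.
  by rewrite (_ : in_tuple s = Tuple sn) //; apply: val_inj.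
have [|||K [Kml KE]] := @solve_family R k (fun s => phi (\prod_(y <- s) y)) H.
- move=> _ s t a x y _; rewrite !big_cat !big_cons /=.
  rewrite -linearP; congr (phi _).
  by rewrite mulrDl mulrDr -scalerAl ncpoly_scaleAr.
- move=> K K' x x0 KK'; apply: eq_bigr => P /andP[PS PT].
  apply: eq_bigr => j _; apply: eq_bigr => V VP; apply: floc; apply: KK'.
  by rewrite size_restr; apply: part_block_size (Spart _ _ PS) PT VP.
- move=> K n Kml s t a x y sn.
  have sz w : size (s ++ w :: t) == n by rewrite size_cat /= addnS sn.
  rewrite (HE K n (Tuple (sz (a *: x + y)))) (HE K n (Tuple (sz x))).
  rewrite (HE K n (Tuple (sz y))) mulr_sumr -big_split /=.
  apply: eq_bigr => P /andP[PS PT]; rewrite mulr_sumr -big_split /=.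
  apply: eq_bigr => j _; apply: (mln_prod (Spart _ _ PS)) => // V VP.
  apply: fml; apply: Kml; apply: part_block_size (Spart _ _ PS) PT VP.
  by rewrite -sn.
exists K; split=> // n x n0; rewrite KE ?size_tuple // HE.
rewrite [RHS](bigD1 [set setT]) ?ST //=; congr (_ + _).
by rewrite JT !big_set1 restrT fT.
Qed.

Lemma solve_unique (R : realType) (k : nat) (phi : {scalar ncpoly R k})
    (S : forall n, {set {set {set 'I_n}}})
    (J : forall n, {set {set 'I_n}} -> {set {set 'I_n}})
    (f : cumfamily R k -> forall n, {set {set 'I_n}} -> {set 'I_n} -> {set 'I_n} ->
         cumfamily R k) :
  (forall n P, P \in S n -> partition P setT) ->
  (forall n, (0 < n)%N -> [set setT] \in S n) ->
  (forall n, J n [set setT] = [set setT]) ->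
  (forall K n, f K n [set setT] setT setT =1 K) ->
  (forall K K' n P j V y, K y = K' y -> f K n P j V y = f K' n P j V y) ->
  forall K K' : cumfamily R k,
  (forall n (x : n.-tuple (ncpoly R k)), (0 < n)%N ->
      phi (\prod_(y <- x) y) =
      \sum_(P in S n) \sum_(j in J n P) \prod_(V in P) f K n P j V (restr x V)) ->
  (forall n (x : n.-tuple (ncpoly R k)), (0 < n)%N ->
      phi (\prod_(y <- x) y) =
      \sum_(P in S n) \sum_(j in J n P) \prod_(V in P) f K' n P j V (restr x V)) ->
  forall x, (0 < size x)%N -> K x = K' x.
Proof.
move=> Spart ST JT fT floc K K' KE KE' x.
move: {2}(size x) (leqnn (size x)) => d; elim: d x => [|d IH] x xd x0.
  by move: x0; rewrite ltnNge xd.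
have := KE _ (in_tuple x) x0; rewrite (KE' _ (in_tuple x) x0).
rewrite [LHS](bigD1 [set setT]) ?ST //= [RHS](bigD1 [set setT]) ?ST //=.
rewrite !JT !big_set1 !restrT !fT /= => E; apply/esym; move: E.
set a := (X in _ + X = _ -> _); set b := (X in _ = _ + X -> _).
suff -> : a = b by move/addIr.
apply: eq_bigr => P /andP[PS PT]; apply: eq_bigr => j _.
apply: eq_bigr => V VP; apply: floc.
have /andP[V0 Vn] := part_block_size x0 (Spart _ _ PS) PT VP.
by apply/esym; apply: IH; rewrite size_restr // -ltnS (leq_trans Vn).
Qed.


Lemma NC_part n P : P \in NC n -> partition P setT.
Proof. by rewrite inE => /andP[]. Qed.

Lemma Int_part n P : P \in Int n -> partition P setT.
Proof. by rewrite inE => /andP[]. Qed.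

Definition is_free_cumulants (R : realType) (k : nat) (mu : Dalg R k)
    (kappa : cumfamily R k) :=
  multilinear kappa /\
  forall (n : nat) (x : n.-tuple (ncpoly R k)), (0 < n)%N ->
    mu (\prod_(y <- x) y) =
    \sum_(P in NC n) \prod_(V in P) kappa (restr x V).

Lemma free_cumulants_exist (R : realType) (k : nat) (mu : Dalg R k) :
  exists kappa, is_free_cumulants mu kappa.
Proof.
have [||||||K [Kml KE]] := @solve_cumulants R k mu NC
  (fun n _ => [set setT]) (fun K _ _ _ _ => K) => //.
- exact: NC_part.
- exact: NC_T.
exists K; split=> // n x n0; rewrite KE //.
by apply: eq_bigr => P _; rewrite big_set1.
Qed.

Lemma free_cumulants_unique (R : realType) (k : nat) (mu : Dalg R k) K K' :
  is_free_cumulants mu K -> is_free_cumulants mu K' ->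
  forall x, (0 < size x)%N -> K x = K' x.
Proof.
move=> [_ KE] [_ KE']; apply: (@solve_unique R k mu NC
  (fun n _ => [set setT]) (fun K _ _ _ _ => K)) => //.
- exact: NC_part.
- exact: NC_T.
- by move=> n x n0; rewrite KE //; apply: eq_bigr => P _; rewrite big_set1.
- by move=> n x n0; rewrite KE' //; apply: eq_bigr => P _; rewrite big_set1.
Qed.

Definition free_cumulants (R : realType) (k : nat) (mu : Dalg R k) :
  cumfamily R k := projT1 (cid (free_cumulants_exist mu)).

Lemma free_cumulantsP (R : realType) (k : nat) (mu : Dalg R k) :
  is_free_cumulants mu (free_cumulants mu).
Proof. exact: projT2 (cid (free_cumulants_exist mu)). Qed.

Definition is_boolean_cumulants (R : realType) (k : nat) (nu : Dalg R k)
    (beta : cumfamily R k) :=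
  multilinear beta /\
  forall (n : nat) (x : n.-tuple (ncpoly R k)), (0 < n)%N ->
    nu (\prod_(y <- x) y) =
    \sum_(P in Int n) \prod_(V in P) beta (restr x V).

Lemma boolean_cumulants_exist (R : realType) (k : nat) (nu : Dalg R k) :
  exists beta, is_boolean_cumulants nu beta.
Proof.
have [||||||K [Kml KE]] := @solve_cumulants R k nu Int
  (fun n _ => [set setT]) (fun K _ _ _ _ => K) => //.
- exact: Int_part.
- exact: Int_T.
exists K; split=> // n x n0; rewrite KE //.
by apply: eq_bigr => P _; rewrite big_set1.
Qed.

Lemma boolean_cumulants_unique (R : realType) (k : nat) (nu : Dalg R k) K K' :
  is_boolean_cumulants nu K -> is_boolean_cumulants nu K' ->
  forall x, (0 < size x)%N -> K x = K' x.
Proof.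
move=> [_ KE] [_ KE']; apply: (@solve_unique R k nu Int
  (fun n _ => [set setT]) (fun K _ _ _ _ => K)) => //.
- exact: Int_part.
- exact: Int_T.
- by move=> n x n0; rewrite KE //; apply: eq_bigr => P _; rewrite big_set1.
- by move=> n x n0; rewrite KE' //; apply: eq_bigr => P _; rewrite big_set1.
Qed.

Definition boolean_cumulants (R : realType) (k : nat) (nu : Dalg R k) :
  cumfamily R k := projT1 (cid (boolean_cumulants_exist nu)).

Lemma boolean_cumulantsP (R : realType) (k : nat) (nu : Dalg R k) :
  is_boolean_cumulants nu (boolean_cumulants nu).
Proof. exact: projT2 (cid (boolean_cumulants_exist nu)). Qed.

Definition is_cfree_cumulants (R : realType) (k : nat) (mu nu : Dalg R k)
    (kappac : cumfamily R k) :=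
  multilinear kappac /\
  forall (n : nat) (x : n.-tuple (ncpoly R k)), (0 < n)%N ->
    nu (\prod_(y <- x) y) =
    \sum_(P in NC n)
      (\prod_(V in P | inner_block P V) free_cumulants mu (restr x V)) *
      (\prod_(W in P | ~~ inner_block P W) kappac (restr x W)).

Lemma cfree_prod (R : realType) (k n : nat) (P : {set {set 'I_n}})
    (kappa kappac : cumfamily R k) (x : n.-tuple (ncpoly R k)) :
  (\prod_(V in P | inner_block P V) kappa (restr x V)) *
    (\prod_(W in P | ~~ inner_block P W) kappac (restr x W)) =
  \sum_(j in [set [set: 'I_n]])
     \prod_(V in P) (if inner_block P V then kappa else kappac) (restr x V).
Proof.
rewrite big_set1 [RHS](bigID (inner_block P)) /=; congr (_ * _).
  by apply: eq_bigr => V /andP[_ ->].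
by apply: eq_bigr => V /andP[_ /negbTE->].
Qed.

Lemma cfree_cumulants_exist (R : realType) (k : nat) (mu nu : Dalg R k) :
  exists kappac, is_cfree_cumulants mu nu kappac.
Proof.
have [||||||K [Kml KE]] := @solve_cumulants R k nu NC
  (fun n _ => [set setT])
  (fun K n P _ V => if inner_block P V then free_cumulants mu else K) => //.
- exact: NC_part.
- exact: NC_T.
- by move=> K n x; rewrite inner_partT.
- move=> K n P _ V m Km; case: ifP => _ // s t a x y _.
  by case: (free_cumulantsP mu) => + _; apply.
- by move=> K K' n P _ V y KK'; case: ifP.
exists K; split=> // n x n0; rewrite KE //.
by apply: eq_bigr => P _; rewrite cfree_prod.
Qed.

Lemma cfree_cumulants_unique (R : realType) (k : nat) (mu nu : Dalg R k) K K' :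
  is_cfree_cumulants mu nu K -> is_cfree_cumulants mu nu K' ->
  forall x, (0 < size x)%N -> K x = K' x.
Proof.
move=> [_ KE] [_ KE']; apply: (@solve_unique R k nu NC
  (fun n _ => [set setT])
  (fun K n P _ V => if inner_block P V then free_cumulants mu else K)) => //.
- exact: NC_part.
- exact: NC_T.
- by move=> {KE KE'} K0 n x; rewrite inner_partT.
- by move=> {KE KE'} K0 K1 n P _ V y KK'; case: ifP.
- by move=> n x n0; rewrite KE //; apply: eq_bigr => P _; rewrite cfree_prod.
- by move=> n x n0; rewrite KE' //; apply: eq_bigr => P _; rewrite cfree_prod.
Qed.

Definition cfree_cumulants (R : realType) (k : nat) (mu nu : Dalg R k) :
  cumfamily R k := projT1 (cid (cfree_cumulants_exist mu nu)).

Lemma cfree_cumulantsP (R : realType) (k : nat) (mu nu : Dalg R k) :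
  is_cfree_cumulants mu nu (cfree_cumulants mu nu).
Proof. exact: projT2 (cid (cfree_cumulants_exist mu nu)). Qed.

Definition is_inf_cumulants (R : realType) (k : nat) (mu : Dalg R k)
    (mu' : Dalg' R k) (kappa' : cumfamily R k) :=
  multilinear kappa' /\
  forall (n : nat) (x : n.-tuple (ncpoly R k)), (0 < n)%N ->
    mu' (\prod_(y <- x) y) =
    \sum_(P in NC n) \sum_(Vo in P)
      kappa' (restr x Vo) *
      \prod_(V in P | V != Vo) free_cumulants mu (restr x V).

Lemma inf_prod (R : realType) (k n : nat) (P : {set {set 'I_n}})
    (kappa kappa' : cumfamily R k) (x : n.-tuple (ncpoly R k)) :
  \sum_(Vo in P) kappa' (restr x Vo) *
     \prod_(V in P | V != Vo) kappa (restr x V) =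
  \sum_(Vo in P) \prod_(V in P) (if V == Vo then kappa' else kappa) (restr x V).
Proof.
apply: eq_bigr => Vo VP; rewrite [RHS](bigD1 Vo) //= eqxx; congr (_ * _).
by apply: eq_bigr => V /andP[_ /negbTE->].
Qed.

Lemma inf_cumulants_exist (R : realType) (k : nat) (mu : Dalg R k)
    (mu' : Dalg' R k) : exists kappa', is_inf_cumulants mu mu' kappa'.
Proof.
have [||||||K [Kml KE]] := @solve_cumulants R k mu' NC (fun n P => P)
  (fun K n P j V => if V == j then K else free_cumulants mu) => //.
- exact: NC_part.
- exact: NC_T.
- by move=> K n x; rewrite eqxx.
- move=> K n P j V m Km; case: ifP => _ // s t a x y _.
  by case: (free_cumulantsP mu) => + _; apply.
- by move=> K K' n P j V y KK'; case: ifP.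
exists K; split=> // n x n0; rewrite KE //.
by apply: eq_bigr => P _; rewrite inf_prod.
Qed.

Lemma inf_cumulants_unique (R : realType) (k : nat) (mu : Dalg R k)
    (mu' : Dalg' R k) K K' :
  is_inf_cumulants mu mu' K -> is_inf_cumulants mu mu' K' ->
  forall x, (0 < size x)%N -> K x = K' x.
Proof.
move=> [_ KE] [_ KE']; apply: (@solve_unique R k mu' NC (fun n P => P)
  (fun K n P j V => if V == j then K else free_cumulants mu)) => //.
- exact: NC_part.
- exact: NC_T.
- by move=> {KE KE'} K0 n x; rewrite eqxx.
- by move=> {KE KE'} K0 K1 n P j V y KK'; case: ifP.
- by move=> n x n0; rewrite KE //; apply: eq_bigr => P _; rewrite inf_prod.
- by move=> n x n0; rewrite KE' //; apply: eq_bigr => P _; rewrite inf_prod.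
Qed.

Definition inf_cumulants (R : realType) (k : nat) (mu : Dalg R k)
  (mu' : Dalg' R k) : cumfamily R k := projT1 (cid (inf_cumulants_exist mu mu')).

Lemma inf_cumulantsP (R : realType) (k : nat) (mu : Dalg R k)
    (mu' : Dalg' R k) : is_inf_cumulants mu mu' (inf_cumulants mu mu').
Proof. exact: projT2 (cid (inf_cumulants_exist mu mu')). Qed.

(* (i_m, ..., i_n, i_1, ..., i_m), with m counted from 0. *)
Definition cycword (T : Type) (m : nat) (w : seq T) : seq T :=
  drop m w ++ take m.+1 w.

Definition is_Psi (R : realType) (k : nat) (nu : Dalg R k) (mu' : Dalg' R k) :=
  forall (n : nat) (i : n.-tuple 'I_k), (0 < n)%N ->
    mu' (\prod_(j <- i) ncX R j) =
    \sum_(m < n) boolean_cumulants nu [seq ncX R j | j <- cycword m i].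

Lemma ncpoly_scaleU (R : realType) (k : nat) (a c : R[i]) (m : {fmonom 'I_k}) :
  a *: (<< c *g m >> : ncpoly R k) = << a * c *g m >>.
Proof.
have <- : a%:MP * (<< c *g m >> : ncpoly R k) = _ := mul_malgC a _.
by rewrite [LHS]fgmulUU mul1m.
Qed.

Lemma prod_ncX (R : realType) (k : nat) (w : seq 'I_k) :
  \prod_(j <- w) ncX R j = << FMonom w >>.
Proof.
elim: w => [|j w IH]; first by rewrite big_nil -fmoneE.
rewrite big_cons IH [LHS]fgmulUU mulr1; congr mkmalgU.
by apply: val_inj; rewrite /= fmM fmU.
Qed.

Lemma Psi_exists (R : realType) (k : nat) (nu : Dalg R k) :
  exists mu', is_Psi nu mu'.
Proof.
pose h (w : {fmonom 'I_k}) : R[i] := \sum_(m < size w)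
  boolean_cumulants nu [seq ncX R j | j <- cycword m w].
pose g : ncpoly R k -> R[i] := mmap idfun h.
have gl : scalar g.
  move=> a p q; rewrite /g raddfD /=; congr (_ + _).
  rewrite [p in LHS]monalgE [p in RHS]monalgE scaler_sumr !raddf_sum /= mulr_sumr.
  apply: eq_bigr => m _; rewrite ncpoly_scaleU !mmapU /=.
  by rewrite mulrA.
pose gL := GRing.isLinear.Build _ _ _ _ g gl.
pose G : {scalar ncpoly R k} := HB.pack g gL.
have G1 : G 1 = 0.
  rewrite -[1](big_nil (1 : ncpoly R k) *%R xpredT (fun j : 'I_k => ncX R j)).
  by rewrite prod_ncX /= /g mmapU /h /= big_ord0 mulr0.
exists (MkDalg' G1) => n i n0 /=.
by rewrite prod_ncX /= /g mmapU /h /= mul1r size_tuple.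
Qed.

Lemma Psi_unique (R : realType) (k : nat) (nu : Dalg R k) mu1 mu2 :
  is_Psi nu mu1 -> is_Psi nu mu2 -> mu1 =1 mu2.
Proof.
move=> h1 h2 p; rewrite [p]monalgE !linear_sum; apply: eq_bigr => -[w] _.
have -> c : << c *g FMonom w >> = c *: \prod_(j <- w) ncX R j.
  by rewrite prod_ncX ncpoly_scaleU mulr1.
rewrite !linearZ /=; congr (_ * _).
case: w => [|j w]; first by rewrite big_nil !Dalg'_one.
by rewrite (h1 _ (in_tuple (j :: w))) // (h2 _ (in_tuple (j :: w))).
Qed.

Definition Psi (R : realType) (k : nat) (nu : Dalg R k) : Dalg' R k :=
  projT1 (cid (Psi_exists nu)).

Lemma PsiP (R : realType) (k : nat) (nu : Dalg R k) : is_Psi nu (Psi nu).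
Proof. exact: projT2 (cid (Psi_exists nu)). Qed.

(* Main.v *)
(* Write g(U; x) for the sum, over the non-crossing partitions P having U as a
   block, of the product of the free cumulants kappa of mu over the other blocks
   of P. Collecting the partitions according to the marked block gives
   mu'(x) = sum_U kappa'(x|U) g(U; x). Splitting a partition after the maximum
   of its first block and comparing Int with NC gives
   beta(y) = sum_U kappa^(c)(y|U) g(U; y), over the U containing both endpoints.
   As mu is tracial, kappa is invariant under cyclic rotation, hence so is g;
   moreover, when y is x followed by one more letter and U contains the first
   position, adjoining the last position to U turns g(U; x) into the same value
   for y. Applied to the cyclic words defining Psi(nu), these facts yield
   mu'(x) = sum_U (sum_p kappa^(c)(cycword p (x|U))) g(U; x). The two expansions
   of mu' have g([n]; x) = 1, so induction on n identifies the coefficients. *)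

Require Import Defs.
From HB Require Import structures.
From mathcomp Require Import all_boot all_order all_algebra.
From mathcomp Require Import boolp reals complex.
From mathcomp Require Import monalg.
From mathcomp Require Import zify.

Set Implicit Arguments.
Unset Strict Implicit.
Unset Printing Implicit Defensive.

Import GRing.Theory.
Local Open Scope ring_scope.

(** * Elementwise criteria for partitions, non-crossing partitions and interval partitions *)

Lemma partP (T : finType) (P : {set {set T}}) :
  reflect [/\ set0 \notin P, forall i, exists2 V, V \in P & i \in V
            & forall V W i, V \in P -> W \in P -> i \in V -> i \in W -> V = W]
          (partition P setT).
Proof.
apply: (iffP and3P) => [[/eqP cP tP P0]|[P0 cP dP]]; split=> //.
- move=> i; have : i \in cover P by rewrite cP inE.
  by move=> /bigcupP[V VP iV]; exists V.
- by move=> V W i VP WP iV iW; rewrite -(def_pblock tP VP iV) (def_pblock tP WP iW).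
- by apply/eqP/setP=> i; rewrite inE; have [V VP iV] := cP i; apply/bigcupP; exists V.
- apply/trivIsetP=> V W VP WP; apply: contraNT => /pred0Pn[i /andP[iV iW]].
  by apply/eqP; apply: dP iV iW.
Qed.

Lemma noncrossingP (n : nat) (P : {set {set 'I_n}}) :
  reflect (forall V W (a b c d : 'I_n), V \in P -> W \in P ->
             a \in V -> b \in W -> c \in V -> d \in W ->
             (a < b)%N -> (b < c)%N -> (c < d)%N -> V = W)
          (noncrossing P).
Proof.
apply: (iffP forall_inP) => [h V W a b c d VP WP aV bW cV dW ab bc cd|h V VP].
  apply/eqP; apply: contraT => VW.
  have /forall_inP/(_ W WP) := h V VP; rewrite VW /= => /negP[].
  by apply/exists_inP; exists a => //; apply/exists_inP; exists b => //;
     apply/exists_inP; exists c => //; apply/exists_inP; exists d => //; apply/and3P.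
apply/forall_inP => W WP; apply/implyP; apply: contraNN.
move=> /exists_inP[a aV /exists_inP[b bW /exists_inP[c cV /exists_inP[d dW]]]].
by case/and3P=> ab bc cd; apply/eqP; apply: (h V W a b c d).
Qed.

Lemma NCE (n : nat) P : (P \in NC n) = partition P setT && noncrossing P.
Proof. by rewrite inE. Qed.

Lemma IntP (n : nat) (P : {set {set 'I_n}}) :
  reflect (partition P setT /\ forall V (a b c : 'I_n), V \in P ->
             a \in V -> b \in V -> (a <= c)%N -> (c <= b)%N -> c \in V)
          (P \in Int n).
Proof.
rewrite inE; apply: (iffP andP) => [[pP /forall_inP h]|[pP h]]; split=> //.
  move=> V a b c VP aV bV ac cb.
  have /forall_inP/(_ a aV)/forall_inP/(_ b bV)/forallP/(_ c) := h V VP.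
  by rewrite ac cb.
apply/forall_inP => V VP; apply/forall_inP => a aV; apply/forall_inP => b bV.
by apply/forallP => c; apply/implyP => /andP[ac cb]; apply: (h V a b c).
Qed.

Lemma Int_sub_NC (n : nat) P : P \in Int n -> P \in NC n.
Proof.
move=> /IntP[pP h]; rewrite NCE pP /=; have [_ _ dP] := partP _ pP.
apply/noncrossingP => V W a b c d VP WP aV bW cV dW ab bc cd.
by apply: (dP V W b) => //; apply: (h V a c b) => //; apply: ltnW.
Qed.

(** Serves to identify the number of positions of a block lying before m with the rank of m inside
    that block. *)
Lemma count_take_index (T : eqType) (a : pred T) (s : seq T) (x : T) :
  a x -> index x (filter a s) = count a (take (index x s) s).
Proof.
move=> ax; elim: s => //= y s IH; have [->|yx] := eqVneq y x.
  by rewrite ax /= eqxx.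
by case ay: (a y); rewrite /= ?(negbTE yx) IH ay.
Qed.

(** * Rotation of non-crossing partitions *)

(** Positivity of n is drawn from the element [i] itself, so no hypothesis on n is carried
    around. *)
Definition rot_ord (n m : nat) (i : 'I_n) : 'I_n :=
  Ordinal (ltn_pmod (i + m) (leq_ltn_trans (leq0n i) (ltn_ord i))).

Lemma rot_ordE (n m : nat) (i : 'I_n) : (m <= n)%N ->
  val (rot_ord m i) = (if i + m < n then i + m else i + m - n)%N.
Proof.
move=> mn /=; have := ltn_ord i => hi; case: ifP => h; first by rewrite modn_small.
have e : (i + m = n + (i + m - n))%N by lia.
by rewrite e modnDl modn_small; lia.
Qed.

Lemma rot_ord_inj (n m : nat) : (m <= n)%N -> injective (@rot_ord n m).
Proof.
move=> mn i j /(congr1 val); rewrite !rot_ordE // => e; apply: val_inj => /=.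
by move: e (ltn_ord i) (ltn_ord j); do 2!case: ifP; lia.
Qed.

(** Preimages are taken because the letter at position i of [rot m x] is the letter of [x] at
    position [rot_ord m i]: a block and its preimage read the same letters up to rotation. *)
Definition rot_part (n m : nat) (P : {set {set 'I_n}}) : {set {set 'I_n}} :=
  [set @rot_ord n m @^-1: (V : {set _}) | V in P].

Lemma map_rot_ord (n m : nat) : (m <= n)%N ->
  map (@rot_ord n m) (enum 'I_n) = rot m (enum 'I_n).
Proof.
move=> mn; apply: (inj_map val_inj); rewrite map_rot val_enum_ord -map_comp.
have -> : rot m (iota 0 n) = iota m (n - m) ++ iota 0 m.
  by rewrite /rot drop_iota take_iota add0n (minn_idPl mn).
apply: (@eq_from_nth _ 0%N) => [|j].
  by rewrite size_map size_enum_ord size_cat !size_iota; lia.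
rewrite size_map size_enum_ord => jn.
rewrite (nth_map (Ordinal jn)) ?size_enum_ord //= nth_enum_ord //.
rewrite nth_cat size_iota.
have e : val (rot_ord m (Ordinal jn)) = ((j + m) %% n)%N by [].
rewrite -e rot_ordE //=; case: ifP => h; case: ifP => h'; try by lia.
  by rewrite nth_iota; lia.
by rewrite nth_iota; lia.
Qed.

Section Rotation.
Variables (n m : nat).
Hypothesis mn : (m <= n)%N.
Let rho := @rot_ord n m.

Let bij_rho : bijective rho := injF_bij (rot_ord_inj mn).

Lemma preim_rot_inj : injective (fun V : {set 'I_n} => rho @^-1: V).
Proof.
have [g gK Kg] := bij_rho.
by move=> V W /setP e; apply/setP => i; have := e (g i); rewrite !inE Kg.
Qed.

Lemma rot_part_inj : injective (@rot_part n m).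
Proof. exact: imset_inj preim_rot_inj. Qed.

Lemma mem_rot_part (P : {set {set 'I_n}}) (V : {set 'I_n}) :
  (rho @^-1: V \in rot_part m P) = (V \in P).
Proof. by rewrite /rot_part mem_imset //; exact: preim_rot_inj. Qed.

Lemma rot_part_NC P : P \in NC n -> rot_part m P \in NC n.
Proof.
rewrite !NCE => /andP[/partP[P0 cP dP] /noncrossingP ncP].
have [g gK Kg] := bij_rho.
apply/andP; split.
  apply/partP; split.
  - apply/imsetP => -[V VP /setP e].
    have /set0Pn[i iV] : V != set0 by apply: contraNneq P0 => <-.
    by have := e (g i); rewrite !inE -/rho Kg iV.
  - move=> i; have [V VP iV] := cP (rho i).
    by exists (rho @^-1: V); rewrite ?mem_rot_part ?inE.
  - move=> _ _ i /imsetP[V VP ->] /imsetP[W WP ->]; rewrite !inE => iV iW.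
    by rewrite (dP V W (rho i)).
apply/noncrossingP => _ _ a b c d /imsetP[V VP ->] /imsetP[W WP ->].
rewrite !inE -/rho => aV bW cV dW ab bc cd; suff -> : V = W by [].
have lo (i : 'I_n) : (i + m < n)%N -> (rho i = i + m :> nat)%N.
  by move=> h; rewrite /rho rot_ordE // h.
have hi (i : 'I_n) : (i + m < n)%N = false -> (rho i = i + m - n :> nat)%N.
  by move=> h; rewrite /rho rot_ordE // h.
have [[an bn] [cn dn]] := ((ltn_ord a, ltn_ord b), (ltn_ord c, ltn_ord d)).
(* Rotation preserves the cyclic order, so the images of a < b < c < d increase after one of four
   cyclic shifts, according to how many of them wrap around. Each shift is again an alternation of V
   and W, possibly with the two exchanged. *)
have nc1 := ncP V W (rho a) (rho b) (rho c) (rho d) VP WP aV bW cV dW.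
have nc2 := ncP W V (rho d) (rho a) (rho b) (rho c) WP VP dW aV bW cV.
have nc3 := ncP V W (rho c) (rho d) (rho a) (rho b) VP WP cV dW aV bW.
have nc4 := ncP W V (rho b) (rho c) (rho d) (rho a) WP VP bW cV dW aV.
case ha: (a + m < n)%N; last first.
  by apply: nc1; rewrite !hi; lia.
case hb: (b + m < n)%N; last first.
  by apply/esym/nc4; rewrite ?(lo a) ?(hi b) ?(hi c) ?(hi d); lia.
case hc: (c + m < n)%N; last first.
  by apply: nc3; rewrite ?(lo a) ?(lo b) ?(hi c) ?(hi d); lia.
case hd: (d + m < n)%N; last first.
  by apply/esym/nc2; rewrite ?(lo a) ?(lo b) ?(lo c) ?(hi d); lia.
by apply: nc1; rewrite !lo; lia.
Qed.

(** An injective map of a finite set into itself is onto. *)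
Lemma rot_part_imset : @rot_part n m @: NC n = NC n.
Proof.
apply/eqP; rewrite eqEcard (card_imset _ rot_part_inj) leqnn andbT.
by apply/subsetP => _ /imsetP[P PN ->]; exact: rot_part_NC.
Qed.

Lemma big_NC_rot (A : zmodType) (F : {set {set 'I_n}} -> A) :
  \sum_(P in NC n) F P = \sum_(P in NC n) F (rot_part m P).
Proof.
by rewrite -[in LHS]rot_part_imset big_imset //= => P Q _ _ /rot_part_inj.
Qed.

Lemma big_rot_part (A : comNzRingType) (P : {set {set 'I_n}}) (U : pred {set 'I_n})
    (f : {set 'I_n} -> A) :
  \prod_(V in rot_part m P | U V) f V =
  \prod_(V in P | U (rho @^-1: V)) f (rho @^-1: V).
Proof.
rewrite big_mkcondr [RHS]big_mkcondr /= [LHS]big_imset //= => V W _ _.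
exact: preim_rot_inj.
Qed.

Lemma indicator_rot (U : {set 'I_n}) :
  [seq i \in rho @^-1: U | i <- enum 'I_n] =
  rot m [seq i \in U | i <- enum 'I_n].
Proof.
rewrite -map_rot -map_rot_ord // -[RHS]map_comp; apply: eq_map => i /=.
by rewrite inE.
Qed.

Lemma restr_rot (T : Type) (x : n.-tuple T) (U : {set 'I_n}) :
  restr (rot_tuple m x) (rho @^-1: U) =
  rot (count id (take m [seq i \in U | i <- enum 'I_n])) (restr x U).
Proof.
by rewrite !restr_mask indicator_rot /= mask_rot // size_map size_enum_ord size_tuple.
Qed.

End Rotation.

(** Traciality makes the moments of [s] and [rot m s] equal. Expanding both over [NC n], with the
    second sum reindexed by rotation, each block of a partition other than the one-block one carries
    a shorter word, whose cumulant is rotation invariant by induction. Those terms cancel and leave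
    the two full cumulants. *)
Lemma free_cumulants_rot (R : realType) (k : nat) (mu : Dalg R k) (s : seq (ncpoly R k)) m :
  tracial mu -> free_cumulants mu (rot m s) = free_cumulants mu s.
Proof.
move=> hmu; have [_ KE] := free_cumulantsP mu.
set K := free_cumulants mu.
have [N] := ubnP (size s); elim: N s m => // N IH s m sN.
have [ms|ms] := leqP (size s) m; first by rewrite rot_oversize.
set n := size s; have n0 : (0 < n)%N by apply: leq_ltn_trans ms.
pose x : n.-tuple (ncpoly R k) := in_tuple s.
have Ksplit (f : {set 'I_n} -> R[i]) : \sum_(P in NC n) \prod_(V in P) f V =
    f setT + \sum_(P in NC n | P != [set setT]) \prod_(V in P) f V.
  by rewrite (bigD1 [set setT]) ?NC_T //= big_set1.
have e : mu (\prod_(y <- rot_tuple m x) y) = mu (\prod_(y <- x) y).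
  by rewrite /= /rot -{3}(cat_take_drop m s) !big_cat /=; exact: hmu.
move: e; rewrite !KE // (big_NC_rot (ltnW ms)).
under eq_bigr => P _.
  rewrite /rot_part big_imset; last by move=> V W _ _; exact: preim_rot_inj (ltnW ms) V W.
  over.
rewrite /= (Ksplit (fun V => K (restr (rot_tuple m x) (rot_ord m @^-1: V)))).
rewrite (Ksplit (fun V => K (restr x V))) preimsetT !restrT.
have cancel (b c : R[i]) : b = c -> K (rot m x) + b = K x + c -> K (rot m s) = K s.
  by move=> -> /addIr.
apply: cancel.
apply: eq_bigr => P /andP[PN PT]; apply: eq_bigr => V VP.
rewrite (restr_rot (ltnW ms)); apply: IH.
rewrite size_restr.
have /andP[_ h] := part_block_size n0 (NC_part PN) PT VP.
by apply: leq_trans h _.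
Qed.

(* For [U] a set of positions, the total weight of what surrounds [U] in the
   non-crossing partitions having [U] as a block. *)
Definition surround (T : Type) (A : comNzRingType) (kappa : seq T -> A) (n : nat)
    (x : n.-tuple T) (U : {set 'I_n}) : A :=
  \sum_(P in NC n | U \in P) \prod_(W in P | W != U) kappa (restr x W).

(** Allows later sums to run over all sets of positions: the empty set, where the families of
    cumulants are unconstrained, contributes nothing. *)
Lemma surround_set0 (T : Type) (A : comNzRingType) (kappa : seq T -> A) (n : nat)
    (x : n.-tuple T) : surround kappa x set0 = 0.
Proof.
by apply: big_pred0 => P; apply/negP => /andP[/NC_part/partition0->].
Qed.

(** Only the one-block partition has the full set as a block. This gives the leading coefficient 1
    when two expansions are compared. *)
Lemma surround_setT (T : Type) (A : comNzRingType) (kappa : seq T -> A) (n : nat)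
    (x : n.-tuple T) : (0 < n)%N -> surround kappa x setT = 1.
Proof.
move=> n0; rewrite /surround (big_pred1 [set setT]) => [|P /=].
  by rewrite big_pred0 // => V; rewrite inE andbN.
apply/andP/eqP => [[/NC_part pP TP]|->]; last by rewrite NC_T // set11.
apply/eqP; apply: contraT => PT.
by have := part_block_size n0 pP PT TP; rewrite cardsT card_ord ltnn andbF.
Qed.

Lemma surround_rot (T : Type) (A : comNzRingType) (kappa : seq T -> A)
    (n m : nat) (x : n.-tuple T) (U : {set 'I_n}) : (m <= n)%N ->
  (forall p s, kappa (rot p s) = kappa s) ->
  surround kappa (rot_tuple m x) (@rot_ord n m @^-1: U) = surround kappa x U.
Proof.
move=> mn Krot; rewrite /surround big_mkcondr [RHS]big_mkcondr /=.
rewrite (big_NC_rot mn); apply: eq_bigr => P _; rewrite mem_rot_part //.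
case: ifP => // _; rewrite big_rot_part //=.
apply: eq_big => [V|V _]; last by rewrite restr_rot // Krot.
by rewrite (inj_eq (preim_rot_inj mn)).
Qed.

(** * Adjoining the last position to a block *)

Section Closing.
Variables (n : nat).
Let e : 'I_n.+1 -> 'I_n.+2 := widen_ord (leqnSn n.+1).

Let e_inj : injective e.
Proof. by move=> i j /(congr1 val) /= ij; apply: val_inj. Qed.

Let e_max i : (e i == ord_max) = false.
Proof. by rewrite -val_eqE /= ltn_eqF. Qed.

Let eP (j : 'I_n.+2) : j != ord_max -> exists i, j = e i.
Proof.
rewrite -val_eqE /= => jm; have jn : (j < n.+1)%N by have := ltn_ord j; lia.
by exists (Ordinal jn); apply: val_inj.
Qed.

Let ltP (i j : 'I_n.+2) : (i < j)%N -> exists i', i = e i'.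
Proof.
move=> ij; apply: eP; apply: contraTneq ij => ->.
by rewrite -leqNgt -ltnS; exact: ltn_ord.
Qed.

(** Meant for cyclic words: [cycword] is a rotated word followed by a repetition of its first
    letter, and the added position carries that repetition. *)
Definition close (U : {set 'I_n.+1}) : {set 'I_n.+2} :=
  ord_max |: widen_ord (leqnSn n.+1) @: U.

Definition close_part (U : {set 'I_n.+1}) (P : {set {set 'I_n.+1}}) :
    {set {set 'I_n.+2}} :=
  close U |: [set widen_ord (leqnSn n.+1) @: (W : {set _}) | W in P :\ U].

(** Forgets the last position. A block reduced to that position would leave an empty set behind;
    [open_partK] excludes this case because the block concerned also contains position 0. *)
Definition open_part (P : {set {set 'I_n.+2}}) : {set {set 'I_n.+1}} :=
  [set widen_ord (leqnSn n.+1) @^-1: (W : {set _}) | W in P].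

Lemma mem_close U i : (widen_ord (leqnSn n.+1) i \in close U) = (i \in U).
Proof. by rewrite !inE -/e e_max mem_imset. Qed.

Lemma open_close U : e @^-1: close U = U.
Proof. by apply/setP => i; rewrite inE mem_close. Qed.

Lemma openK (W : {set 'I_n.+1}) : e @^-1: (e @: W) = W.
Proof. by apply/setP => i; rewrite inE mem_imset. Qed.

Lemma imset_openK (W : {set 'I_n.+2}) : ord_max \notin W -> e @: (e @^-1: W) = W.
Proof.
move=> mW; apply/setP => j; have [->|/eP[i ->]] := eqVneq j ord_max.
  rewrite (negbTE mW); apply/negbTE/imsetP => -[i _ /esym/eqP].
  by rewrite e_max.
by rewrite mem_imset // inE.
Qed.

Lemma close_openK (W : {set 'I_n.+2}) : ord_max \in W -> close (e @^-1: W) = W.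
Proof.
move=> mW; apply/setP => j; have [->|/eP[i ->]] := eqVneq j ord_max.
  by rewrite mW !inE eqxx.
by rewrite mem_close inE.
Qed.

Lemma close_notin U (P : {set {set 'I_n.+1}}) :
  close U \notin [set e @: (W : {set _}) | W in P].
Proof.
apply/imsetP => -[W _ /setP/(_ ord_max)]; rewrite !inE eqxx => /esym/imsetP[i _ /esym/eqP].
by rewrite e_max.
Qed.

Lemma close_partK U (P : {set {set 'I_n.+1}}) : U \in P -> open_part (close_part U P) = P.
Proof.
move=> UP; rewrite /open_part /close_part imsetU1 open_close -imset_comp.
rewrite (eq_imset (g := id)) ?imset_id ?setD1K // => W.
by rewrite /= openK.
Qed.

Lemma open_partK (U : {set 'I_n.+1}) (P : {set {set 'I_n.+2}}) :
  ord0 \in U -> P \in NC n.+2 -> close U \in P ->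
  [/\ open_part P \in NC n.+1, U \in open_part P & close_part U (open_part P) = P].
Proof.
move=> U0 + CP; rewrite !NCE => /andP[/partP[P0 cP dP] /noncrossingP ncP].
have mP W : W \in P -> W != close U -> ord_max \notin W.
  move=> WP; apply: contra => mW; apply/eqP; apply: (dP _ _ ord_max) => //.
  by rewrite !inE eqxx.
have UO : U \in open_part P by apply/imsetP; exists (close U); rewrite ?open_close.
split=> //.
  apply/andP; split.
    apply/partP; split.
    - apply/imsetP => -[W WP W0].
      have [WC|WC] := eqVneq W (close U).
        by move: U0; rewrite -(open_close U) -WC -[_ @^-1: _]W0 inE.
      by move: P0; rewrite -(imset0 e) W0 -/e imset_openK ?WP // mP.
    - move=> i; have [V VP iV] := cP (e i).
      by exists (e @^-1: V); rewrite ?inE //; apply/imsetP; exists V.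
    - move=> _ _ i /imsetP[V VP ->] /imsetP[W WP ->]; rewrite !inE => iV iW.
      by rewrite (dP V W (e i)).
  apply/noncrossingP => _ _ a b c d /imsetP[V VP ->] /imsetP[W WP ->].
  rewrite !inE => aV bW cV dW ab bc cd.
  by rewrite (ncP V W (e a) (e b) (e c) (e d)).
apply/setP => W; rewrite /close_part -/e in_setU1.
have [->|WC] /= := eqVneq W (close U); first by rewrite CP.
apply/imsetP/idP => [[V]|WP].
  rewrite !inE => /andP[VU /imsetP[V' V'P e1]] ->.
  rewrite e1 -/e imset_openK // mP //.
  by apply: contraNneq VU => V'C; rewrite e1 V'C -/e open_close.
exists (e @^-1: W); last by rewrite imset_openK // mP.
rewrite !inE; apply/andP; split; last by apply/imsetP; exists W.
(* If [W] had trace [U], it would share position 0 with [close U], hence equal it. *)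
apply: contraNneq WC => WU; apply/eqP; apply: (dP _ _ (e ord0)) => //.
  by move: U0; rewrite -WU inE.
by rewrite mem_close.
Qed.

(** Since [U] contains position 0, a block crossing the enlarged block would already cross [U] in
    [P]. *)
Lemma close_part_NC (U : {set 'I_n.+1}) (P : {set {set 'I_n.+1}}) :
  ord0 \in U -> P \in NC n.+1 -> U \in P ->
  close_part U P \in NC n.+2.
Proof.
move=> U0 + UP; rewrite !NCE => /andP[/partP[P0 cP dP] /noncrossingP ncP].
have cpP W : W \in close_part U P -> W = close U \/ exists2 V, V \in P & V != U /\ W = e @: V.
  rewrite in_setU1 => /orP[/eqP|/imsetP[V]]; first by left.
  by rewrite !inE => /andP[VU VP] ->; right; exists V.
have inV V W i : W \in P -> V \in P -> i \in V -> i \in W -> V = W.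
  by move=> WP VP; exact: dP.
(* Here a and c in [close U] each precede another point, so neither is the new last position. *)
have crossCW W (a b c d : 'I_n.+2) : W \in P -> W != U ->
    a \in close U -> b \in e @: W -> c \in close U -> d \in e @: W ->
    (a < b)%N -> (b < c)%N -> (c < d)%N -> False.
  move=> WP WU aU /imsetP[b' b'W ->] cU /imsetP[d' d'W ->] ab bc cd.
  have [a' ea] := ltP ab.
  have [c' ec] := ltP cd.
  move: aU cU; rewrite ea ec !mem_close => aU cU.
  move: ab bc cd; rewrite ea ec /= => ab bc cd.
  by case/eqP: WU; rewrite (ncP U W a' b' c' d').
(* Only d can be the new last position. Position 0, placed before a, takes over its role as a point
   of [U]. *)
have crossWC W (a b c d : 'I_n.+2) : W \in P -> W != U ->
    a \in e @: W -> b \in close U -> c \in e @: W -> d \in close U ->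
    (a < b)%N -> (b < c)%N -> (c < d)%N -> False.
  move=> WP WU /imsetP[a' a'W ->] bU /imsetP[c' c'W ->] dU ab bc cd.
  have [b' eb] := ltP bc.
  move: bU; rewrite eb mem_close => bU; move: ab bc; rewrite eb /= => ab bc.
  case/eqP: WU; have [a0|a0] := posnP a'.
    by rewrite (dP U W a') // (_ : a' = ord0) //; apply: val_inj.
  by rewrite (ncP U W ord0 a' b' c').
apply/andP; split.
  apply/partP; split.
  - apply/negP => /cpP[/setP/(_ ord_max)|[V VP [_ /esym/eqP]]]; first by rewrite !inE eqxx.
    by rewrite imset_eq0 => /eqP V0; rewrite -V0 VP in P0.
  - move=> j; have [->|/eP[i ->]] := eqVneq j ord_max.
      by exists (close U); rewrite ?inE ?eqxx.
    have [V VP iV] := cP i; have [VU|VU] := eqVneq V U.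
      by exists (close U); rewrite ?mem_close -?VU // VU !inE eqxx.
    exists (e @: V); last by rewrite mem_imset.
    by rewrite in_setU1; apply/orP; right; rewrite imset_f // !inE VU.
  - move=> V W i /cpP[->|[V' V'P [V'U ->]]] /cpP[->|[W' W'P [W'U ->]]] //.
    + move=> iC /imsetP[j jW ij]; move: iC; rewrite ij mem_close => jU.
      by case/eqP: W'U; rewrite (dP U W' j).
    + move=> /imsetP[j jV ->]; rewrite mem_close => jU.
      by case/eqP: V'U; rewrite (dP U V' j).
    + by move=> /imsetP[j jV ->]; rewrite mem_imset // => jW; rewrite (dP V' W' j).
apply/noncrossingP => V W a b c d.
move=> /cpP[->|[V' V'P [V'U ->]]] /cpP[->|[W' W'P [W'U ->]]] // aV bW cV dW ab bc cd.
- by case: (crossCW W' a b c d).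
- by case: (crossWC V' a b c d).
move: aV bW cV dW ab bc cd.
move=> /imsetP[a' aV ->] /imsetP[b' bW ->] /imsetP[c' cV ->] /imsetP[d' dW ->] /= ab bc cd.
by rewrite (ncP V' W' a' b' c' d').
Qed.

Lemma restr_rcons_widen (T : Type) (x : n.+1.-tuple T) (a : T) (W : {set 'I_n.+1}) :
  restr (rcons_tuple x a) (e @: W) = restr x W.
Proof.
rewrite !restr_mask enum_ordSr map_rcons -map_comp.
have -> : (ord_max \in e @: W) = false.
  by apply/negbTE/imsetP => -[i _ /esym/eqP]; rewrite e_max.
rewrite mask_rcons; last by rewrite size_map size_enum_ord size_tuple.
rewrite /= cats0.
by congr mask; apply: eq_map => i /=; rewrite mem_imset.
Qed.

Lemma restr_rcons_close (T : Type) (x : n.+1.-tuple T) (a : T) (U : {set 'I_n.+1}) :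
  restr (rcons_tuple x a) (close U) = rcons (restr x U) a.
Proof.
rewrite !restr_mask enum_ordSr map_rcons -map_comp.
rewrite !inE eqxx mask_rcons; last by rewrite size_map size_enum_ord size_tuple.
rewrite /= cats1.
by congr (rcons (mask _ _) _); apply: eq_map => i; rewrite /= mem_close.
Qed.

(** [close_part U] and [open_part] are mutually inverse between the partitions having [U] as a block
    and those having [close U], and the other blocks keep their letters. *)
Lemma surround_close (T : Type) (A : comNzRingType) (kappa : seq T -> A)
    (x : n.+1.-tuple T) (a : T) (U : {set 'I_n.+1}) : ord0 \in U ->
  surround kappa (rcons_tuple x a) (close U) = surround kappa x U.
Proof.
move=> U0; rewrite /surround (reindex_onto (close_part U) open_part); last first.
  by move=> P /andP[PN CP]; have [] := open_partK U0 PN CP.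
apply: eq_big => [P|P /andP[/andP[PN CP] /eqP PK]].
  apply/andP/andP => [[/andP[PN CP] /eqP PK]|[PN UP]].
    by have [] := open_partK U0 PN CP; rewrite PK.
  by rewrite close_part_NC // close_partK // !inE !eqxx.
have [_ UP _] := open_partK U0 PN CP; rewrite PK in UP.
have D m (Q : {set {set 'I_m}}) (V : {set 'I_m}) (F : {set 'I_m} -> A) :
    \prod_(W in Q | W != V) F W = \prod_(W in Q :\ V) F W.
  by apply: eq_bigl => W; rewrite !inE andbC.
rewrite !D /close_part setU1K ?close_notin // big_imset /=.
  by apply: eq_bigr => W _; rewrite restr_rcons_widen.
by move=> V W _ _; exact: imset_inj e_inj V W.
Qed.

End Closing.

(** * Juxtaposition of partitions *)

Lemma blockmin_le (n : nat) (V : {set 'I_n}) i : i \in V -> (blockmin V <= i)%N.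
Proof.
move=> iV; rewrite /blockmin; have := mem_index_enum i.
elim: (index_enum _) => // j s IH; rewrite big_cons inE => /orP[/eqP <-|/IH is_].
  by rewrite iV geq_minl.
by case: ifP => // _; rewrite (leq_trans (geq_minr _ _)).
Qed.

Lemma blockmin_mem (n : nat) (V : {set 'I_n}) : V != set0 ->
  exists2 i, i \in V & blockmin V = i.
Proof.
move=> /set0Pn[i iV].
(* The neutral value n of the minimum is a possible outcome of the fold, excluded afterwards by an
   element of [V] below n. *)
have : blockmin V = n \/ exists2 i, i \in V & blockmin V = i.
  apply: (big_ind (fun m => m = n \/ exists2 i, i \in V & m = i))
    => [|a b ha hb|j jV]; [by left| |by right; exists j].
  by rewrite /minn; case: ifP.
by case=> // e; have := blockmin_le iV; rewrite e leqNgt ltn_ord.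
Qed.

Lemma blockmax_ge (n : nat) (V : {set 'I_n}) i : i \in V -> (i <= blockmax V)%N.
Proof. by move=> iV; exact: (@leq_bigmax_cond _ (mem V) (@nat_of_ord n)). Qed.

Lemma blockmax_mem (n : nat) (V : {set 'I_n}) : V != set0 ->
  exists2 i, i \in V & blockmax V = i.
Proof.
by rewrite -card_gt0 => V0; have [i iV e] := eq_bigmax_cond (@nat_of_ord n) V0; exists i.
Qed.

(** Any two points of the enclosing block replace its minimum and maximum; this form passes through
    injections of positions without computing extrema. *)
Lemma inner_blockP (n : nat) (P : {set {set 'I_n}}) (V : {set 'I_n}) :
  set0 \notin P -> V != set0 ->
  reflect (exists W a b, [/\ W \in P, a \in W, b \in W &
             forall v, v \in V -> (a < v < b)%N]) (inner_block P V).
Proof.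
move=> P0 V0; apply: (iffP exists_inP) => [[W WP /and3P[h1 _ h2]]|].
  have W0 : W != set0 by apply: contraNneq P0 => <-.
  have [a aW ea] := blockmin_mem W0; have [b bW eb] := blockmax_mem W0.
  exists W, a, b; split=> // v vV; rewrite -ea -eb.
  by rewrite (leq_trans h1 (blockmin_le vV)) (leq_ltn_trans (blockmax_ge vV) h2).
move=> [W [a [b [WP aW bW h]]]]; exists W => //.
have [v vV ev] := blockmin_mem V0; have [w wV ew] := blockmax_mem V0.
have /andP[av _] := h v vV; have /andP[_ wb] := h w wV.
apply/and3P; split.
- by rewrite ev (leq_ltn_trans (blockmin_le aW)).
- by rewrite ev blockmax_ge.
- by rewrite ew (leq_trans wb) // blockmax_ge.
Qed.

(** Both lists are strictly increasing and have the same members. *)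
Lemma enum_imset_mono (m n : nat) (h : 'I_m -> 'I_n) (V : {set 'I_m}) :
  {homo h : i j / (i < j)%N} -> enum (h @: V) = map h (enum V).
Proof.
move=> hmono; have enum_lt k (W : {set 'I_k}) : sorted (fun i j : 'I_k => (i < j)%N) (enum W).
  rewrite /enum_mem; apply: sorted_filter; first by move=> a b c; exact: ltn_trans.
  by have := iota_ltn_sorted 0 k; rewrite -val_enum_ord sorted_map enumT.
apply: (@irr_sorted_eq _ (fun i j : 'I_n => (i < j)%N)).
- by move=> a b c; exact: ltn_trans.
- by move=> a; rewrite ltnn.
- exact: enum_lt.
- by rewrite sorted_map; apply: sub_sorted (enum_lt _ V) => i j; exact: hmono.
- move=> j; rewrite mem_enum; apply/imsetP/mapP => -[i iV ->]; exists i => //.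
    by rewrite mem_enum.
  by rewrite mem_enum in iV.
Qed.

(** The word is a function on all of nat, so that passing to a shifted segment changes no type. *)
Definition subword (T : Type) (n : nat) (x : nat -> T) (V : {set 'I_n}) : seq T :=
  [seq x (val i) | i <- enum V].

Lemma subword_restr (T : Type) (n : nat) (x : nat -> T) (V : {set 'I_n}) :
  subword x V = restr [tuple x i | i < n] V.
Proof. by apply: eq_map => i; rewrite tnth_mktuple. Qed.

Section Join.
Variables (p q : nat).
Let l : 'I_p -> 'I_(p + q) := @lshift p q.
Let r : 'I_q -> 'I_(p + q) := @rshift p q.

Let l_inj : injective l. Proof. exact: lshift_inj. Qed.
Let r_inj : injective r. Proof. exact: rshift_inj. Qed.
Let lr i j : l i <> r j.
Proof. by move=> /eqP; rewrite eq_lrshift. Qed.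
Let lrP (j : 'I_(p + q)) : (exists i, j = l i) \/ (exists i, j = r i).
Proof. by rewrite -(splitK j); case: (split j) => i; [left|right]; exists i. Qed.

Definition join_part (P1 : {set {set 'I_p}}) (P2 : {set {set 'I_q}}) :
    {set {set 'I_(p + q)}} :=
  [set @lshift p q @: (V : {set _}) | V in P1] :|: [set @rshift p q @: (V : {set _}) | V in P2].

(** [set0] is removed because a block contained in the right half has empty trace on the left
    one. *)
Definition left_part (P : {set {set 'I_(p + q)}}) : {set {set 'I_p}} :=
  [set @lshift p q @^-1: (V : {set _}) | V in P] :\ set0.

Definition right_part (P : {set {set 'I_(p + q)}}) : {set {set 'I_q}} :=
  [set @rshift p q @^-1: (V : {set _}) | V in P] :\ set0.

Let llK (V : {set 'I_p}) : l @^-1: (l @: V) = V.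
Proof. by apply/setP => i; rewrite inE mem_imset. Qed.
Let rrK (V : {set 'I_q}) : r @^-1: (r @: V) = V.
Proof. by apply/setP => i; rewrite inE mem_imset. Qed.
Let lr0 (V : {set 'I_q}) : l @^-1: (r @: V) = set0.
Proof. by apply/setP => i; rewrite !inE; apply/imsetP => -[j _ /lr]. Qed.
Let rl0 (V : {set 'I_p}) : r @^-1: (l @: V) = set0.
Proof. by apply/setP => i; rewrite !inE; apply/imsetP => -[j _ /esym/lr]. Qed.

Variant join_spec (P1 : {set {set 'I_p}}) (P2 : {set {set 'I_q}}) :
    {set 'I_(p + q)} -> Prop :=
  | JoinLeft V of V \in P1 : join_spec P1 P2 (l @: V)
  | JoinRight V of V \in P2 : join_spec P1 P2 (r @: V).

Lemma joinP (P1 : {set {set 'I_p}}) (P2 : {set {set 'I_q}}) W :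
  W \in join_part P1 P2 -> join_spec P1 P2 W.
Proof. by rewrite inE => /orP[] /imsetP[V VP ->]; [left|right]. Qed.

Lemma join_l (P1 : {set {set 'I_p}}) (P2 : {set {set 'I_q}}) (V : {set 'I_p}) :
  V \in P1 -> l @: V \in join_part P1 P2.
Proof. by move=> VP; rewrite inE imset_f. Qed.

Lemma join_r (P1 : {set {set 'I_p}}) (P2 : {set {set 'I_q}}) (V : {set 'I_q}) :
  V \in P2 -> r @: V \in join_part P1 P2.
Proof. by move=> VP; rewrite inE orbC imset_f. Qed.

Lemma join_set0 (P1 : {set {set 'I_p}}) (P2 : {set {set 'I_q}}) :
  (set0 \notin join_part P1 P2) = (set0 \notin P1) && (set0 \notin P2).
Proof.
apply/idP/andP => [h|[h1 h2]].
  by split; apply: contra h => h; [have := join_l P2 h|have := join_r P1 h]; rewrite imset0.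
(* The empty set is named by a variable so that case analysis with [joinP] retains its equation with
   the image of a block. *)
apply/negP => h; have [W e] : {W | W = set0 :> {set 'I_(p + q)}} by exists set0.
rewrite -e in h; case: (joinP h) e => V VP /eqP; rewrite imset_eq0 => /eqP V0.
  by rewrite -V0 VP in h1.
by rewrite -V0 VP in h2.
Qed.

Lemma left_join (P1 : {set {set 'I_p}}) (P2 : {set {set 'I_q}}) :
  set0 \notin P1 -> left_part (join_part P1 P2) = P1.
Proof.
move=> P0; apply/setP => V; rewrite !inE; apply/andP/idP => [[V0 /imsetP[W]]|VP].
  by move/joinP=> [V' V'P|V' V'P]; rewrite ?llK ?lr0 => e; rewrite e // eqxx in V0 *.
split; first by apply: contraNneq P0 => <-.
by apply/imsetP; exists (l @: V); rewrite ?join_l // llK.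
Qed.

Lemma right_join (P1 : {set {set 'I_p}}) (P2 : {set {set 'I_q}}) :
  set0 \notin P2 -> right_part (join_part P1 P2) = P2.
Proof.
move=> P0; apply/setP => V; rewrite !inE; apply/andP/idP => [[V0 /imsetP[W]]|VP].
  by move/joinP=> [V' V'P|V' V'P]; rewrite ?rrK ?rl0 => e; rewrite e // eqxx in V0 *.
split; first by apply: contraNneq P0 => <-.
by apply/imsetP; exists (r @: V); rewrite ?join_r // rrK.
Qed.

(** When no block meets both halves, every block is the image of its trace on the half that it
    meets. *)
Lemma join_partK (P : {set {set 'I_(p + q)}}) : set0 \notin P ->
  (forall W a b, W \in P -> l a \in W -> r b \in W -> False) ->
  join_part (left_part P) (right_part P) = P.
Proof.
move=> P0 h.
have hl W i : W \in P -> l i \in W -> l @: (l @^-1: W) = W.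
  move=> WP iW; apply/setP => j; have [[a ->]|[a ->]] := lrP j.
    by rewrite mem_imset // inE.
  apply/imsetP/idP => [[b _ /esym/lr]//|aW]; by case: (h W i a).
have hr W i : W \in P -> r i \in W -> r @: (r @^-1: W) = W.
  move=> WP iW; apply/setP => j; have [[a ->]|[a ->]] := lrP j; last first.
    by rewrite mem_imset // inE.
  apply/imsetP/idP => [[b _ /lr]//|aW]; by case: (h W a i).
apply/setP => W; apply/idP/idP => [/joinP[V|V]|WP].
- rewrite !inE => /andP[/set0Pn[i iV] /imsetP[W' W'P e]].
  by rewrite e (hl _ i) //; move: iV; rewrite e inE.
- rewrite !inE => /andP[/set0Pn[i iV] /imsetP[W' W'P e]].
  by rewrite e (hr _ i) //; move: iV; rewrite e inE.
have /set0Pn[j jW] : W != set0 by apply: contraNneq P0 => <-.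
have [[i ej]|[i ej]] := lrP j; rewrite ej in jW.
  rewrite -(hl W i) //; apply: join_l; rewrite !inE; apply/andP; split.
    by apply/set0Pn; exists i; rewrite inE.
  by apply/imsetP; exists W.
rewrite -(hr W i) //; apply: join_r; rewrite !inE; apply/andP; split.
  by apply/set0Pn; exists i; rewrite inE.
by apply/imsetP; exists W.
Qed.

Lemma partition_join (P1 : {set {set 'I_p}}) (P2 : {set {set 'I_q}}) :
  partition (join_part P1 P2) setT = partition P1 setT && partition P2 setT.
Proof.
apply/partP/andP => [[]|[/partP[z1 c1 d1] /partP[z2 c2 d2]]].
  rewrite join_set0 => /andP[z1 z2] c d; split; apply/partP; split=> //.
  - move=> i; have [W /joinP[V VP|V VP]] := c (l i).
      by rewrite mem_imset // => iV; exists V.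
    by case/imsetP => j _ /lr.
  - move=> V W i VP WP iV iW.
    by apply: (imset_inj l_inj); apply: (d _ _ (l i)); rewrite ?join_l ?mem_imset.
  - move=> i; have [W /joinP[V VP|V VP]] := c (r i).
      by case/imsetP => j _ /esym/lr.
    by rewrite mem_imset // => iV; exists V.
  - move=> V W i VP WP iV iW.
    by apply: (imset_inj r_inj); apply: (d _ _ (r i)); rewrite ?join_r ?mem_imset.
split; first by rewrite join_set0 z1.
  move=> j; have [[i ->]|[i ->]] := lrP j.
    by have [V VP iV] := c1 i; exists (l @: V); rewrite ?join_l ?mem_imset.
  by have [V VP iV] := c2 i; exists (r @: V); rewrite ?join_r ?mem_imset.
move=> V W i /joinP[V' V'P|V' V'P] /joinP[W' W'P|W' W'P] /imsetP[a aV ->] /imsetP[b bW e].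
- by rewrite (d1 V' W' b) // -(l_inj e).
- by case: (lr e).
- by case: (lr (esym e)).
- by rewrite (d2 V' W' b) // -(r_inj e).
Qed.

Lemma noncrossing_join (P1 : {set {set 'I_p}}) (P2 : {set {set 'I_q}}) :
  noncrossing (join_part P1 P2) = noncrossing P1 && noncrossing P2.
Proof.
apply/noncrossingP/andP => [h|[/noncrossingP h1 /noncrossingP h2]].
  split; apply/noncrossingP => V W a b c d VP WP aV bW cV dW ab bc cd.
    by apply: (imset_inj l_inj); apply: (h _ _ (l a) (l b) (l c) (l d));
       rewrite ?join_l ?mem_imset.
  by apply: (imset_inj r_inj); apply: (h _ _ (r a) (r b) (r c) (r d));
     rewrite ?join_r ?mem_imset ?ltn_add2l.
move=> V W a b c d /joinP[V' V'P|V' V'P] /joinP[W' W'P|W' W'P];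
  move=> /imsetP[a' aV ->] /imsetP[b' bW ->] /imsetP[c' cV ->] /imsetP[d' dW ->] /=.
- by move=> ab bc cd; rewrite (h1 V' W' a' b' c' d').
- by have := ltn_ord c'; lia.
- by have := ltn_ord b'; lia.
- by rewrite !ltn_add2l => ab bc cd; rewrite (h2 V' W' a' b' c' d').
Qed.

Lemma NC_join (P1 : {set {set 'I_p}}) (P2 : {set {set 'I_q}}) :
  (join_part P1 P2 \in NC (p + q)) = (P1 \in NC p) && (P2 \in NC q).
Proof. by rewrite !NCE partition_join noncrossing_join andbACA. Qed.

Lemma Int_join (P1 : {set {set 'I_p}}) (P2 : {set {set 'I_q}}) :
  (join_part P1 P2 \in Int (p + q)) = (P1 \in Int p) && (P2 \in Int q).
Proof.
apply/IntP/andP => [[]|[/IntP[p1 h1] /IntP[p2 h2]]].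
  rewrite partition_join => /andP[p1 p2] h; split; apply/IntP; split=> // V a b c VP aV bV ac cb.
    by rewrite -(mem_imset _ _ l_inj) (h _ (l a) (l b)) ?join_l ?mem_imset.
  by rewrite -(mem_imset _ _ r_inj) (h _ (r a) (r b)) ?join_r ?mem_imset ?leq_add2l.
split; first by rewrite partition_join p1.
move=> V a b c /joinP[V' V'P|V' V'P] /imsetP[a' aV ->] /imsetP[b' bV ->] /=;
  have [[c' ->]|[c' ->]] := lrP c; rewrite /= ?mem_imset // ?leq_add2l.
- exact: h1.
- by have := ltn_ord b'; lia.
- by have := ltn_ord c'; lia.
- exact: h2.
Qed.

(** A block of the right half has no point before a left block, so it cannot enclose it. *)
Lemma inner_join_l (P1 : {set {set 'I_p}}) (P2 : {set {set 'I_q}}) (V : {set 'I_p}) :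
  set0 \notin P1 -> set0 \notin P2 -> V \in P1 ->
  inner_block (join_part P1 P2) (l @: V) = inner_block P1 V.
Proof.
move=> z1 z2 VP; have V0 : V != set0 by apply: contraNneq z1 => <-.
apply/inner_blockP/inner_blockP; rewrite ?join_set0 ?z1 ?imset_eq0 //.
  move=> [W [a [b [/joinP[W' W'P|W' W'P] /imsetP[a' aW ->] /imsetP[b' bW ->] h]]]].
    by exists W', a', b'; split=> // v vV; apply: (h (l v)); rewrite mem_imset.
  have /set0Pn[v vV] := V0; have := h (l v); rewrite mem_imset // => /(_ vV) /=.
  by have := ltn_ord v; lia.
move=> [W [a [b [WP aW bW h]]]]; exists (l @: W), (l a), (l b).
by split; rewrite ?join_l ?mem_imset // => _ /imsetP[v vV ->]; exact: h.
Qed.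

Lemma inner_join_r (P1 : {set {set 'I_p}}) (P2 : {set {set 'I_q}}) (V : {set 'I_q}) :
  set0 \notin P1 -> set0 \notin P2 -> V \in P2 ->
  inner_block (join_part P1 P2) (r @: V) = inner_block P2 V.
Proof.
move=> z1 z2 VP; have V0 : V != set0 by apply: contraNneq z2 => <-.
apply/inner_blockP/inner_blockP; rewrite ?join_set0 ?z1 ?imset_eq0 //.
  move=> [W [a [b [/joinP[W' W'P|W' W'P] /imsetP[a' aW ->] /imsetP[b' bW ->] h]]]].
    have /set0Pn[v vV] := V0; have := h (r v); rewrite mem_imset // => /(_ vV) /=.
    by have := ltn_ord b'; lia.
  exists W', a', b'; split=> // v vV; have := h (r v); rewrite mem_imset // => /(_ vV).
  by rewrite /= !ltn_add2l.
move=> [W [a [b [WP aW bW h]]]]; exists (r @: W), (r a), (r b).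
split; rewrite ?join_r ?mem_imset // => _ /imsetP[v vV ->] /=; rewrite !ltn_add2l.
exact: h.
Qed.

Lemma big_join (A : comNzRingType) (P1 : {set {set 'I_p}}) (P2 : {set {set 'I_q}})
    (F : {set 'I_(p + q)} -> A) :
  set0 \notin P1 ->
  \prod_(V in join_part P1 P2) F V =
  (\prod_(V in P1) F (l @: V)) * \prod_(V in P2) F (r @: V).
Proof.
move=> z1; rewrite (eq_bigl _ _ (fun V => in_setU V _ _)) bigU /=.
  rewrite !big_imset //= => V W _ _; first exact: imset_inj r_inj V W.
  exact: imset_inj l_inj V W.
rewrite disjoint_subset; apply/subsetP => _ /imsetP[V VP ->].
rewrite inE; apply/imsetP => -[W _ e].
by case/negP: z1; rewrite -(lr0 W) -e llK.
Qed.

Lemma subword_l (T : Type) (x : nat -> T) (V : {set 'I_p}) :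
  subword x (l @: V) = subword x V.
Proof. by rewrite /subword enum_imset_mono // -map_comp. Qed.

Lemma subword_r (T : Type) (x : nat -> T) (V : {set 'I_q}) :
  subword x (r @: V) = subword (fun i => x (p + i)%N) V.
Proof.
rewrite /subword enum_imset_mono; first by rewrite -map_comp.
by move=> i j; rewrite /= ltn_add2l.
Qed.

End Join.

(** * Decomposition along the first outer block *)

(** The boolean argument of [f] tells inner from outer blocks, so that one argument covers the
    Boolean expansion, where it is ignored, and the c-free one, where it selects the family. *)
Definition weight (T : Type) (A : comNzRingType) (f : bool -> seq T -> A) (n : nat)
    (P : {set {set 'I_n}}) (x : nat -> T) : A :=
  \prod_(V in P) f (inner_block P V) (subword x V).

Definition first_max (n : nat) (P : {set {set 'I_n.+1}}) : nat := blockmax (pblock P ord0).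

Lemma first_maxE (n : nat) (P : {set {set 'I_n.+1}}) (V : {set 'I_n.+1}) :
  partition P setT -> V \in P -> ord0 \in V -> first_max P = blockmax V.
Proof. by move=> /and3P[_ tP _] VP V0; rewrite /first_max (def_pblock tP VP V0). Qed.

Lemma first_block (n : nat) (P : {set {set 'I_n.+1}}) : partition P setT ->
  exists2 V, V \in P & ord0 \in V.
Proof. by case/partP => _ + _; apply. Qed.

Lemma blockmax_l (p q : nat) (V : {set 'I_p}) :
  blockmax (@lshift p q @: V) = blockmax V.
Proof. by rewrite /blockmax big_imset // => i j _ _; exact: lshift_inj. Qed.

Section Split.
Variables (T : Type) (A : comNzRingType) (f : bool -> seq T -> A).
(** Stands for both [NC] and [Int]. *)
Variable S : forall n, {set {set {set 'I_n}}}.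
Hypothesis S_NC : forall n P, P \in S n -> P \in NC n.
Hypothesis S_join : forall p q (P1 : {set {set 'I_p}}) (P2 : {set {set 'I_q}}),
  (join_part P1 P2 \in S (p + q)) = (P1 \in S p) && (P2 \in S q).
Hypothesis S_0 : set0 \in S 0.

Definition total (n : nat) (x : nat -> T) : A := \sum_(P in S n) weight f P x.

(* Sum over the partitions with a single outer block. *)
Definition irred (n : nat) (x : nat -> T) : A :=
  \sum_(P in S n.+1 | first_max P == n) weight f P x.

Lemma S_part n P : P \in S n -> partition P setT.
Proof. by move/S_NC/NC_part. Qed.

Lemma S_set0 n P : P \in S n -> set0 \notin P.
Proof. by move/S_part => /and3P[]. Qed.

Lemma weight_join p q (P1 : {set {set 'I_p}}) (P2 : {set {set 'I_q}}) x :
  set0 \notin P1 -> set0 \notin P2 ->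
  weight f (join_part P1 P2) x = weight f P1 x * weight f P2 (fun i => x (p + i)%N).
Proof.
move=> z1 z2; rewrite /weight big_join //; congr (_ * _); apply: eq_bigr => V VP.
  by rewrite inner_join_l // subword_l.
by rewrite inner_join_r // subword_r.
Qed.

Lemma first_max_join p q (P1 : {set {set 'I_p.+1}}) (P2 : {set {set 'I_q}}) :
  partition P1 setT -> partition P2 setT ->
  first_max (join_part P1 P2 : {set {set 'I_(p + q).+1}}) = first_max P1.
Proof.
move=> p1 p2; have [V VP V0] := first_block p1.
have jV : @lshift p.+1 q @: V \in join_part P1 P2 by exact: join_l.
have pj : partition (join_part P1 P2) setT by rewrite partition_join p1.
rewrite (first_maxE p1 VP V0) -(blockmax_l q V).
apply: (@first_maxE (p + q)) => //.
by apply/imsetP; exists ord0 => //; apply: val_inj.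
Qed.

(** Suppose a block contains a <= p and b > p. If a is 0 or p, it is the first block, which ends at
    p. Otherwise 0 < a < p < b is a crossing with the first block. *)
Lemma first_max_split p q (P : {set {set 'I_(p.+1 + q)}}) :
  P \in NC (p.+1 + q) -> first_max (P : {set {set 'I_(p + q).+1}}) = p ->
  join_part (left_part P) (right_part P) = P.
Proof.
rewrite NCE => /andP[pP /noncrossingP ncP] mP; have [P0 _ dP] := partP _ pP.
have [V VP V0] := @first_block (p + q) P pP.
have eV := @first_maxE (p + q) P V pP VP V0; rewrite mP in eV.
have Vn0 : V != set0 by apply/set0Pn; exists ord0.
have [m mV em] := blockmax_mem Vn0.
apply: join_partK => // W a b WP aW bW.
have bV : @rshift p.+1 q b \in V -> False.
  by move/blockmax_ge; rewrite -eV /=; lia.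
suff WV : V = W by apply: bV; rewrite WV.
have [a0|a0] := posnP a; first by
  apply: (dP _ _ ord0) => //; rewrite (_ : ord0 = lshift q a) //; apply: val_inj.
have [ap|ap] := eqVneq (a : nat) p.
  by apply: (dP _ _ m) => //; rewrite (_ : m = lshift q a) //; apply: val_inj; rewrite /= -em -eV.
apply: (ncP V W ord0 (lshift q a) m (rshift p.+1 b)) => //=; rewrite -?em -?eV.
  by have := ltn_ord a; lia.
by lia.
Qed.

(** Cutting after the first block leaves on the left a partition whose first block reaches its last
    position, and on the right an arbitrary member of [S]. *)
Lemma split_at p q (x : nat -> T) :
  \sum_(P in S (p + q).+1 | first_max P == p) weight f P x =
  irred p x * total q (fun i => x (p.+1 + i)%N).
Proof.
rewrite /irred /total big_distrlr /= pair_big /=.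
rewrite (reindex_onto (fun Q => @join_part p.+1 q Q.1 Q.2)
  (fun P : {set {set 'I_(p + q).+1}} => (@left_part p.+1 q P, @right_part p.+1 q P))) /=.
  apply: eq_big => [[P1 P2]|[P1 P2]] /=.
    rewrite (@S_join p.+1 q); apply/andP/andP => [[/andP[/andP[h1 h2] hm] _]|[/andP[h1 hm] h2]].
      by move: hm; rewrite first_max_join ?S_part // h1.
    rewrite first_max_join ?S_part // h1 h2 hm; split=> //.
    by rewrite left_join ?right_join ?S_set0.
  rewrite (@S_join p.+1 q) => /andP[/andP[/andP[h1 h2] _] _].
  by rewrite -weight_join ?S_set0.
move=> P /andP[PS /eqP mP]; apply: (@first_max_split p q) => //.
exact: S_NC.
Qed.

Lemma total0 x : total 0 x = 1.
Proof.
rewrite /total (big_pred1 set0) => [|P /=].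
  by rewrite /weight big_set0.
apply/idP/eqP => [/S_part|-> //].
have -> : [set: 'I_0] = set0 by apply/setP => -[].
by rewrite partition_set0 => /eqP.
Qed.

Lemma totalS n x : total n.+1 x =
  \sum_(p < n.+1) irred p x * total (n - p) (fun i => x (p.+1 + i)%N).
Proof.
rewrite /total (partition_big (fun P => inord (first_max P) : 'I_n.+1) predT) //=.
apply: eq_bigr => p _; have e : n = (p + (n - p))%N by have := ltn_ord p; lia.
transitivity (\sum_(P in S n.+1 | first_max P == p) weight f P x).
  apply: eq_bigl => P; case PS: (P \in S n.+1) => //=.
  rewrite -val_eqE /= inordK // ltnS /first_max.
  by apply/bigmax_leqP => i _; rewrite -ltnS.
(* Generalizing [n - p] to a free q allows n to be replaced by p + q, which avoids casts between
   ordinal types. *)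
move: (val p) (n - p)%N e => {}p q e; subst n; exact: split_at.
Qed.

End Split.

(** The recursion [totalS] is triangular: its last term is [irred] at n times an empty total, equal
    to 1, and the other terms involve only smaller indices, which agree by induction. *)
Lemma irred_unique (T : Type) (A : comNzRingType) (f1 f2 : bool -> seq T -> A)
    (S1 S2 : forall n, {set {set {set 'I_n}}}) :
  (forall n P, P \in S1 n -> P \in NC n) -> (forall n P, P \in S2 n -> P \in NC n) ->
  (forall p q (P1 : {set {set 'I_p}}) (P2 : {set {set 'I_q}}),
    (join_part P1 P2 \in S1 (p + q)%N) = (P1 \in S1 p) && (P2 \in S1 q)) ->
  (forall p q (P1 : {set {set 'I_p}}) (P2 : {set {set 'I_q}}),
    (join_part P1 P2 \in S2 (p + q)%N) = (P1 \in S2 p) && (P2 \in S2 q)) ->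
  set0 \in S1 0%N -> set0 \in S2 0%N ->
  (forall n x, total f1 S1 n.+1 x = total f2 S2 n.+1 x) ->
  forall n x, irred f1 S1 n x = irred f2 S2 n x.
Proof.
move=> N1 N2 J1 J2 Z1 Z2 E; elim/ltn_ind => n IH x.
have E' m y : total f1 S1 m y = total f2 S2 m y by case: m => [|m]; rewrite ?total0.
have := E n x; rewrite !totalS // !big_ord_recr /= subnn !total0 // !mulr1.
rewrite (eq_bigr (fun p : 'I_n => irred f2 S2 p x *
   total f2 S2 (n - p) (fun i => x (p.+1 + i)%N))) => [/addrI//|p _].
by rewrite IH // E'.
Qed.

(** * Cumulants *)

Lemma cycwordE (T : Type) (s : seq T) (p : nat) (a : T) : (p < size s)%N ->
  cycword p s = rcons (rot p s) (nth a s p).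
Proof. by move=> ps; rewrite /cycword (take_nth a) // /rot rcons_cat. Qed.

(** A block containing both endpoints must be the first block, so at most one term survives. *)
Lemma sum_first_max (n : nat) (A : comNzRingType) (P : {set {set 'I_n.+1}})
    (F : {set 'I_n.+1} -> A) : partition P setT ->
  \sum_(U in P | (ord0 \in U) && (ord_max \in U)) F U =
  if first_max P == n then F (pblock P ord0) else 0.
Proof.
move=> pP; have [V VP V0] := first_block pP.
have [_ _ dP] := partP _ pP; have /and3P[_ tP _] := pP.
rewrite (def_pblock tP VP V0) (first_maxE pP VP V0).
have maxE : (blockmax V == n) = (ord_max \in V).
  apply/eqP/idP => [e|mV].
    have [|m mV em] := @blockmax_mem _ V; first by apply/set0Pn; exists ord0.
    by rewrite (_ : ord_max = m) //; apply: val_inj; rewrite /= -em e.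
  apply/eqP; rewrite eqn_leq (blockmax_ge mV) andbT.
  by apply/bigmax_leqP => i _; rewrite -ltnS.
rewrite maxE; case: ifP => mV.
  apply: big_pred1 => U; apply/and3P/eqP => [[UP U0 _]|->] //.
  exact: (dP U V ord0).
apply: big_pred0 => U; apply/negP => /and3P[UP U0 mU].
by rewrite -(dP U V ord0) // mU in mV.
Qed.

(** A first block that reaches the last position encloses every other block, while nothing encloses
    position 0. *)
Lemma inner_first_max (n : nat) (P : {set {set 'I_n.+1}}) (V : {set 'I_n.+1}) :
  P \in NC n.+1 -> first_max P = n -> V \in P ->
  inner_block P V = (V != pblock P ord0).
Proof.
rewrite NCE => /andP[pP _] mP VP; have [U UP U0] := first_block pP.
have [P0 _ dP] := partP _ pP; have /and3P[_ tP _] := pP.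
rewrite (def_pblock tP UP U0).
have Un0 : U != set0 by apply/set0Pn; exists ord0.
have Vn0 : V != set0 by apply: contraNneq P0 => <-.
have [m mU em] := blockmax_mem Un0; rewrite -(first_maxE pP UP U0) mP in em.
apply/inner_blockP/idP => // [[W [a [b [_ _ _ h]]]]|VU].
  by apply/eqP => VU; have := h ord0; rewrite VU ltn0 => /(_ U0).
exists U, ord0, m; split=> // v vV; apply/andP; split.
  rewrite lt0n; apply: contraNneq VU => v0; apply/eqP; apply: (dP _ _ ord0) => //.
  by rewrite (_ : ord0 = v) //; apply: val_inj.
rewrite ltn_neqAle -em -ltnS ltn_ord andbT; apply: contraNneq VU => vn.
apply/eqP; apply: (dP _ _ m) => //.
by rewrite (_ : m = v) //; apply: val_inj; rewrite /= -em vn.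
Qed.

(** By [inner_first_max] the block through both endpoints is the only outer one, hence the only one
    weighted by [kappac]. Exchanging the sums over partitions and over this block produces
    [surround]. *)
Lemma irred_NC (T : Type) (A : comNzRingType) (kappa kappac : seq T -> A)
    (n : nat) (x : nat -> T) :
  irred (fun b => if b then kappa else kappac) NC n x =
  \sum_(U : {set 'I_n.+1} | (ord0 \in U) && (ord_max \in U))
     kappac (subword x U) * surround kappa [tuple x i | i < n.+1] U.
Proof.
transitivity (\sum_(P in NC n.+1) \sum_(U in P | (ord0 \in U) && (ord_max \in U))
    kappac (subword x U) * \prod_(W in P | W != U) kappa (subword x W)).
  rewrite /irred big_mkcondr; apply: eq_bigr => P PN.
  rewrite (sum_first_max _ (NC_part PN)); case: ifP => // /eqP mP.
  have pP := NC_part PN; have [V VP V0] := first_block pP.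
  have eV : pblock P ord0 = V by case/and3P: pP => _ tP _; rewrite (def_pblock tP VP V0).
  rewrite /weight eV (bigD1 V) //= inner_first_max // eV eqxx; congr (_ * _).
  by apply: eq_bigr => W /andP[WP WV]; rewrite inner_first_max // eV WV.
rewrite (exchange_big_dep (fun U : {set 'I_n.+1} => (ord0 \in U) && (ord_max \in U))) /=;
  last by move=> P U _ /andP[].
apply: eq_bigr => U cU; rewrite /surround big_distrr /=.
apply: eq_big => [P|P _]; first by rewrite cU andbT.
by congr (_ * _); apply: eq_bigr => W _; rewrite subword_restr.
Qed.

(** An interval containing both endpoints is everything, so only the one-block partition remains. *)
Lemma irred_Int (T : Type) (A : comNzRingType) (beta : seq T -> A) (n : nat) (x : nat -> T) :
  irred (fun=> beta) Int n x = beta [tuple x i | i < n.+1].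
Proof.
rewrite /irred (big_pred1 [set setT]) => [|P /=].
  by rewrite /weight big_set1 subword_restr restrT.
apply/andP/eqP => [[/IntP[pP iP] /eqP mP]|->].
  have [V VP V0] := first_block pP; have VT : V = setT.
    have [|m mV em] := @blockmax_mem _ V; first by apply/set0Pn; exists ord0.
    apply/setP => i; rewrite inE; apply: (iP V ord0 m) => //.
    by rewrite -em -(first_maxE pP VP V0) mP -ltnS.
  have [P0 _ dP] := partP _ pP.
  apply/setP => W; rewrite inE; apply/idP/eqP => [WP|->]; last by rewrite -VT.
  have /set0Pn[i iW] : W != set0 by apply: contraNneq P0 => <-.
  by rewrite (dP W V i) // VT inE.
rewrite Int_T // (first_maxE (partT (ltn0Sn n)) (set11 _)) ?inE //; split=> //.
rewrite eqn_leq; apply/andP; split.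
  by apply/bigmax_leqP => i _; rewrite -ltnS.
exact: (@blockmax_ge _ setT ord_max).
Qed.

Lemma set0_NC : set0 \in NC 0.
Proof.
rewrite NCE; apply/andP; split; last by apply/noncrossingP => V W a b c d; rewrite inE.
by apply/partP; split=> [||V W i]; rewrite ?inE // => -[].
Qed.

Lemma set0_Int : set0 \in Int 0.
Proof.
apply/IntP; split; last by move=> V a b c; rewrite inE.
by apply/partP; split=> [||V W i]; rewrite ?inE // => -[].
Qed.

Section Cumulants.
Variables (R : realType) (k : nat) (mu nu : Dalg R k).
Local Notation A := (ncpoly R k).
Local Notation kappa := (free_cumulants mu).
Local Notation kappac := (cfree_cumulants mu nu).
Local Notation beta := (boolean_cumulants nu).

(** The moments of [nu] are the totals both of the Boolean weights on [Int] and of the c-free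
    weights on [NC]; by [irred_unique] the irreducible sums agree too. *)
Lemma boolean_cfree (n : nat) (y : n.+1.-tuple A) :
  beta y = \sum_(U : {set 'I_n.+1} | (ord0 \in U) && (ord_max \in U))
             kappac (restr y U) * surround kappa y U.
Proof.
(* The default 0 only fills positions past the end of [y]. *)
pose x i := nth 0 y i.
have ey : y = [tuple x i | i < n.+1].
  by apply: eq_from_tnth => i; rewrite tnth_mktuple /x -tnth_nth.
rewrite {1}ey -irred_Int.
rewrite (@irred_unique _ _ _ (fun b => if b then kappa else kappac) Int NC).
- rewrite irred_NC -ey; apply: eq_bigr => U _.
  by rewrite subword_restr -ey.
- exact: Int_sub_NC.
- by [].
- exact: Int_join.
- exact: NC_join.
- exact: set0_Int.
- exact: set0_NC.
move=> {}n {ey}x {y}.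
have [_ bE] := boolean_cumulantsP nu; have [_ cE] := cfree_cumulantsP mu nu.
transitivity (nu (\prod_(y <- [tuple x i | i < n.+1]) y)).
  rewrite bE //; apply: eq_bigr => P _; apply: eq_bigr => V _.
  by rewrite subword_restr.
rewrite cE //; apply: eq_bigr => P _; rewrite cfree_prod big_set1.
by apply: eq_bigr => V _; rewrite subword_restr.
Qed.

(** The cyclic word is [rot m y] followed by its first letter. Sets of its positions containing both
    endpoints are closures of sets containing 0, and these are rotation preimages of the sets
    containing m. [surround_close] and [surround_rot] preserve the weights along these two changes
    of variable. *)
Lemma boolean_cycword (n : nat) (y : n.+1.-tuple A) (m : 'I_n.+1) : tracial mu ->
  beta (cycword m y) =
  \sum_(U : {set 'I_n.+1} | m \in U)
     kappac (cycword (index m (enum U)) (restr y U)) * surround kappa y U.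
Proof.
move=> hmu; pose a := tnth y m; have mn : (m <= n.+1)%N by rewrite ltnW.
have -> : cycword m y = rcons_tuple (rot_tuple m y) a.
  by rewrite /= (@cycwordE _ y m a) ?size_tuple // -tnth_nth.
rewrite boolean_cfree.
rewrite (reindex_onto (@close n)
  (fun V : {set _} => widen_ord (leqnSn n.+1) @^-1: V)) /=; last first.
  by move=> V /andP[_ mV]; exact: close_openK.
rewrite (reindex_inj (preim_rot_inj mn)) /=.
apply: eq_big => [U|U /andP[/andP[U0 _] _]].
  rewrite open_close eqxx andbT !inE eqxx andbT.
  have -> : ord0 = widen_ord (leqnSn n.+1) ord0 by apply: val_inj.
  rewrite mem_imset; last by move=> i j /(congr1 val) ij; apply: val_inj.
  rewrite inE (_ : rot_ord m ord0 = m) //; apply: val_inj.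
  by rewrite /= add0n modn_small.
have mU : m \in U.
  move: U0; have -> : ord0 = widen_ord (leqnSn n.+1) ord0 by apply: val_inj.
  rewrite mem_close inE (_ : rot_ord m ord0 = m) //; apply: val_inj.
  by rewrite /= add0n modn_small.
have U0' : ord0 \in @rot_ord n.+1 m @^-1: U.
  rewrite inE (_ : rot_ord m ord0 = m) //; apply: val_inj.
  by rewrite /= add0n modn_small.
rewrite restr_rcons_close surround_close // surround_rot //; last first.
  by move=> p s; exact: free_cumulants_rot.
congr (_ * _); congr kappac; rewrite restr_rot //.
(* The letters of [U] are rotated by the number of positions of [U] before m, which is the rank of m
   in [U]. *)
have -> : count id (take m [seq i \in U | i <- enum 'I_n.+1]) = index m (enum U).
  rewrite -map_take count_map {2}/enum_mem -enumT (@count_take_index _ (mem U)) //.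
  by rewrite index_enum_ord.
have iU : (index m (enum U) < size (enum U))%N by rewrite index_mem mem_enum.
rewrite (@cycwordE _ _ _ a) ?size_map //; congr rcons.
by rewrite (nth_map m) // nth_index ?mem_enum.
Qed.

Lemma sum_boolean_cycword (n : nat) (y : n.+1.-tuple A) : tracial mu ->
  \sum_(m < n.+1) beta (cycword m y) =
  \sum_(U : {set 'I_n.+1})
     (\sum_(p < size (restr y U)) kappac (cycword p (restr y U))) * surround kappa y U.
Proof.
move=> hmu; under eq_bigr do rewrite boolean_cycword //.
rewrite (exchange_big_dep predT) //=; apply: eq_bigr => U _.
rewrite -mulr_suml; congr (_ * _).
(* A position m of [U] is now replaced by its rank p in [enum U]. *)
rewrite -big_enum /= (big_nth ord0) big_mkord size_map.
by apply: eq_bigr => p _; rewrite index_uniq ?enum_uniq.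
Qed.

Lemma inf_moment (mu' : Dalg' R k) (n : nat) (x : n.-tuple A) : (0 < n)%N ->
  mu' (\prod_(y <- x) y) =
  \sum_(U : {set 'I_n}) inf_cumulants mu mu' (restr x U) * surround kappa x U.
Proof.
move=> n0; have [_ ->] // := inf_cumulantsP mu mu'.
rewrite (exchange_big_dep predT) //=; apply: eq_bigr => U _.
by rewrite /surround big_distrr.
Qed.

End Cumulants.

(** * Comparison of the two expansions by induction on the length of the word *)

Theorem theorem1p4 (R : realType) (k : nat) (hk : (0 < k)%N)
    (mu nu : Dalg R k) (hmu : tracial mu) (n : nat) (i : n.-tuple 'I_k)
    (hn : (0 < n)%N) :
  inf_cumulants mu (Psi nu) [seq ncX R j | j <- i] =
  \sum_(m < n) cfree_cumulants mu nu [seq ncX R j | j <- cycword m i].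
Proof.
have map_cyc (w : seq 'I_k) m : [seq ncX R j | j <- cycword m w] = cycword m [seq ncX R j | j <- w].
  by rewrite /cycword map_cat map_drop map_take.
elim/ltn_ind: n i hn => -[//|n] IH i _.
pose x := map_tuple (@ncX R k) i.
have xE (U : {set 'I_n.+1}) : restr x U = map (@ncX R k) (restr i U).
  by rewrite /restr -map_comp; apply: eq_map => j /=; rewrite tnth_map.
have restrTx : restr x setT = [seq ncX R j | j <- i] by rewrite restrT.
have PsiE : Psi nu (\prod_(y <- x) y) = \sum_(m < n.+1) boolean_cumulants nu (cycword m x).
  by rewrite /= big_map PsiP //; apply: eq_bigr => m _; rewrite map_cyc.
have := inf_moment mu (Psi nu) x isT; rewrite PsiE (sum_boolean_cycword nu x hmu) /=.
(* On both sides the full set has coefficient 1; the remaining terms will be shown to coincide. *)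
rewrite (bigD1 setT) // [in RHS](bigD1 setT) //= surround_setT // !mulr1 restrTx.
under [in RHS]eq_bigr => U UT.
  rewrite (_ : _ * _ = (\sum_(p < size (restr x U))
    cfree_cumulants mu nu (cycword p (restr x U))) * surround (free_cumulants mu) x U); last first.
    (* The induction hypothesis needs a nonempty word; for the empty set both terms vanish with
       [surround]. *)
    have [->|U0] := eqVneq U set0; first by rewrite surround_set0 !mulr0.
    congr (_ * _); rewrite xE size_map.
    have cU : size (restr i U) = #|U| by exact: size_restr.
    have lU : (#|U| < n.+1)%N.
      rewrite -[X in (_ < X)%N]card_ord -cardsT; apply: proper_card.
      by rewrite properT.
    (* The restriction to a proper subset is again a word in the indeterminates, and a shorter
       one. *)
    rewrite (IH _ _ (in_tuple (restr i U))) ?cU // ?card_gt0 //.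
    by apply: eq_bigr => p _; rewrite map_cyc.
  over.
move/addIr <-; rewrite size_map size_tuple.
by apply: eq_bigr => m _; rewrite map_cyc.
Qed.
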